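(* Let $p$ be a homogeneous real polynomial in $n$ variables with allowable variety $V(p)$. Suppose a non-branching algorithm (in classical rounded arithmetic) evaluates $p$ accurately on $\mathbb R^n$ by computing $p_{comp}(x,\delta)$. Suppose $C$ is a standard change of variables associated with an irreducible component of $V(p)$. Let $p_{dom_j,C}$ be one of the corresponding dominant terms of $p$, associated with a set $\Lambda_j$ of exponents, and let $S_{\Lambda_j}$ satisfy the exponent condition (E) given in the context. Then the pruned algorithm, with output $p_{dom_j,C,comp}(x,\delta)$, evaluates $p_{dom_j,C}$ accurately on $\mathbb R^n$. In other words, being able to compute accurately all such $p_{dom_j,C}$, for all components of the variety $V(p)$ and all standard changes of variables $C$, is a condition necessary to compute $p$ accurately (by a non-branching algorithm).
   Context: **Classical rounded arithmetic (real, non-branching).** A non-branching algorithm receives its input $x\in\mathbb R^n$ exactly and is a finite directed acyclic graph (DAG) with source nodes carrying the variables $x_i$, computational nodes and one output node. Each computational node has two inputs (each a source or the output of another computational node; both may come from the same node), each of which may be negated exactly before use; the node performs one operation $op\in\{+,-,\cdot\}$ and outputs $op(a,b)(1+\delta_i)$, where $\delta_i$ is a real rounding error variable specific to that node, arbitrary subject to $|\delta_i|\le\epsilon$. No constants are available. The output is $p_{comp}(x,\delta)$, and an algorithm for $p$ satisfies $p_{comp}(x,0)=p(x)$. It evaluates $p$ accurately on $\mathbb R^n$ if for every $0<\eta<1$ there is $0<\epsilon<1$ such that $|p_{comp}(x,\delta)-p(x)|\le\eta|p(x)|$ for all $x\in\mathbb R^n$ and all $\delta$ with $|\delta_i|\le\epsilon$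 for all $i$. **Allowable sets.** Allowable hyperplanes: $\{x_i=0\}$, $\{x_i+x_j=0\}$, $\{x_i-x_j=0\}$. $V(p)=\{x\in\mathbb R^n:p(x)=0\}$ is allowable if it is a union of intersections of allowable hyperplanes. Any irreducible component $S$ of an allowable variety is an intersection of allowable hyperplanes and is described by a (possibly empty) zero group of variables, all equal to $0$, and disjoint chains $\sigma_{a}x_{a}=\sigma_{b}x_{b}=\cdots$ with signs $\sigma=\pm1$ (the remaining variables are free). **Changes of variables.** For a chain $\sigma_1x_1=\cdots=\sigma_kx_k$, a basic change of variables chooses one variable $x_j$, the representative of the group, and sets $\tilde x_j=x_j$, $\tilde x_l=x_l-\sigma_j\sigma_lx_j$ for $l\ne j$. For a set given by a zero group and several chains, a basic change of variables is the identity on the zero group (and on free variables) composed with basic changes for each chain. A standard change of variables associated with $S$ is a basic change of variables associated with some irreducible allowable set (intersection of allowable hyperplanes) $\tilde S\supseteq S$ that maps $S$ to the coordinate subspace $\{\tilde x_i=0,\ i\in I\}$, where $I$ consists of the indices of the zero group of $S$ and the indices of all non-representative variables in each chain of $S$. It is written $\tilde x=Cx$. Its groups are the chains of $\tilde S$, each with its representative; all other variables are regarded as forming singleton groups. For $r$ in a group with representative $rep$, write $\tilde x_r=x_r-\sigma_rx_{rep}$ with $\sigma_r=\pm1$ (normalized so that $\sigma_{rep}=1$). **Dominant terms.** Let $k=|I|$. Written in the new variables, $p=\sum_{\lambda\in\Lambda}c_\lambda\,\tilde x_I^{\lambda}\,q_\lambda(\tilde x_{I^c})$, where $\Lambda$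 is the set of multi-indices $\lambda\in\mathbb Z_{\ge0}^k$ occurring in the monomials. Let $P$ be the convex hull of $\Lambda$. Let $\Lambda_j\subseteq\Lambda$ be a subset that determines a face $F$ of $P$ (i.e. the exponents of $\Lambda$ lying on $F$) such that the negative $-N_F$ of its normal cone $N_F=\{\eta: F\subseteq\{x\in P:\eta x=\max_{y\in P}\eta y\}\}$ intersects the nonnegative orthant $(\mathbb R^k)^*_+$ not only at the origin, and let $S_{\Lambda_j}$ be the set of nonnegative row vectors $\eta\in(\mathbb R^k)^*_+$ with $\eta\lambda_1=\eta\lambda_2<\eta\lambda$ for all $\lambda_1,\lambda_2\in\Lambda_j$ and $\lambda\in\Lambda\setminus\Lambda_j$. The corresponding dominant term is $p_{dom_j,C}=\sum_{\lambda\in\Lambda_j}c_\lambda\,\tilde x_I^\lambda\,q_\lambda(\tilde x_{I^c})$, regarded as a polynomial in the original variables $x$ via $\tilde x=Cx$. **Condition (E).** Index $\eta\in S_{\Lambda_j}$ by variables, $\eta=(n_i)_{i\in I}$, and put $n_i=0$ for $i\notin I$. $S_{\Lambda_j}$ satisfies (E) if for every $\eta\in S_{\Lambda_j}$ and every group of $C$ with representative $rep$, $n_{rep}\le n_r$ for all $r$ in the group. **Pruning.** Given the DAG of a non-branching algorithm computing $p_{comp}(x,\delta)$, a standard change of variables $C$ associated with an irreducible component $S$ of $V(p)$, and a subset $\Lambda_j\subseteq\Lambda$ consisting of the exponents of $\Lambda$ lying on a face $F$ of $P$ for which $-N_F$ intersects $(\mathbb R^k)^*_+$ not only at the origin, and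 for which $S_{\Lambda_j}$ satisfies (E), choose any $\eta\in S_{\Lambda_j}$ and formally input the curve $x(t)$ given by $x_{rep}(t)=t^{n_{rep}}x_{rep}$ for each representative, $x_r(t)=t^{n_r}x_r+\sigma_rt^{n_{rep}}x_{rep}$ for each other member $r$ of its group, and $x_i(t)=t^{n_i}x_i$ for singleton groups. Redirection of a source input means replacing an edge from a source $x_j$ to a computational node by an edge from the representative $x_{rep}$ of $x_j$, followed by exact negation if $\sigma_j=-1$ (i.e. replacing $x_j$ by $\sigma_jx_{rep}$). Deletion of a node $i$ with distinct input nodes $k,l$ from node $k$ means deleting the edge from $k$ to $i$, changing the origin of all out-edges of $i$ to the node $l$ (keeping the sign with which $l$ enters $i$, by exact negation), and deleting $i$. Starting at the sources, process each computational node $i$, with inputs $k,l$ already processed; inputs are polynomials in $t$, and $\deg(k),\deg(l)$ denote the degrees of their lowest-degree terms in $t$. - If $op=\cdot$ and one or both inputs are sources: redirect each source input. - If $op=\pm$ and $\deg(k)\ne\deg(l)$, say $\deg(k)>\deg(l)$: delete node $i$ from node $k$. - If $op=\pm$ and $\deg(k)=\deg(l)$: (a) if $k$ and $l$ are both sources and the operation leads to cancellation of their lowest-degree terms in $t$, examine the second-lowest degree terms: if their degrees coincide or one second-lowest term is missing, change nothing; if one degree is bigger than the other, leave unchanged the source containing the lower-degree term and redirect the other source; (b) if only one of $k,l$ is a source, or both are sources but there is no cancellation of lowest-degree terms, redirect each source. Finally delete inductively all nodes no longer on any path to the output. The output of the resulting pruned algorithm is $p_{dom_j,C,comp}(x,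\delta)$.
   Formalization: In pruning, a source x_r is redirected to its representative only if n_rep < n_r; for ties n_r = n_rep it is left as is, since otherwise the claim fails (x_1^2+x_2^2 with S~={x_1=x_2}). The final necessity claim assumes S_{Λ_j} is non-empty, so that η can be chosen. *)

(* Defs.v *)
From HB Require Import structures.
From mathcomp Require Import all_boot all_order all_algebra.
From mathcomp Require Import finmap.
From mathcomp Require Import monalg.
From mathcomp Require Import mpoly.
From mathcomp Require Import classical_sets reals constructive_ereal.

Set Implicit Arguments.
Unset Strict Implicit.
Unset Printing Implicit Defensive.

Import Order.TTheory GRing.Theory Num.Theory.

(* monalg declares a notation of this name in type_scope for another type. *)
Notation "{ 'mpoly' T [ n ] }" := (mpoly.mpoly n T) : type_scope.

Local Open Scope ring_scope.
Local Open Scope classical_set_scope.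

Definition signed (A : zmodType) (s : bool) (a : A) : A := if s then - a else a.

Variant arith := Add | Sub | Mul.

(* A wire with its exact negation flag; it originates at a source (inl) or at
   a computational node (inr). *)
Record edge (n N : nat) := Edge { neg : bool; org : 'I_n + 'I_N }.

Record gate (n N : nat) := Gate {
  gname : 'I_N; gop : arith; lhs : edge n N; rhs : edge n N }.

(* The computational nodes are listed in a topological order. Their names,
   taken in 'I_N, need not exhaust 'I_N: pruning deletes nodes and lets the
   others keep their names, hence their rounding error variables. *)
Record algorithm (n N : nat) := Algorithm {
  gates : seq (gate n N); out : edge n N }.

Section Algorithms.
Variables n N : nat.
Implicit Types (e : edge n N) (g : gate n N).

Definition edge_ok (seen : seq 'I_N) e : bool :=
  if org e is inr i then i \in seen else true.

Fixpoint gates_ok (seen : seq 'I_N) (gs : seq (gate n N)) : bool :=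
  if gs is g :: gs' then
    [&& gname g \notin seen, edge_ok seen (lhs g), edge_ok seen (rhs g)
      & gates_ok (gname g :: seen) gs']
  else true.

Definition is_dag (P : algorithm n N) : bool :=
  gates_ok [::] (gates P) && edge_ok [seq gname g | g <- gates P] (out P).

Definition upd (T : Type) (f : 'I_N -> T) (i : 'I_N) (y : T) : 'I_N -> T :=
  fun j => if j == i then y else f j.

Definition is_source e : bool := if org e is inl _ then true else false.

Definition is_sub (o : arith) : bool := if o is Sub then true else false.

(* Evaluation in an arbitrary ring: the reals for p_comp, and a ring of
   polynomials in t for the pruning process. *)
Section Eval.
Variables (A : nzRingType) (src : 'I_n -> A) (delta : 'I_N -> A).

Definition edge_val (env : 'I_N -> A) e : A :=
  signed (neg e) (match org e with inl j => src j | inr i => env i end).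

Definition gate_val (env : 'I_N -> A) g : A :=
  let a := edge_val env (lhs g) in
  let b := edge_val env (rhs g) in
  match gop g with Add => a + b | Sub => a - b | Mul => a * b end
    * (1 + delta (gname g)).

Fixpoint run (env : 'I_N -> A) (gs : seq (gate n N)) : 'I_N -> A :=
  if gs is g :: gs' then run (upd env (gname g) (gate_val env g)) gs' else env.

Definition output (P : algorithm n N) : A :=
  edge_val (run (fun=> 0) (gates P)) (out P).

End Eval.

Definition evaluates_accurately (R : realType) (P : algorithm n N)
    (p : {mpoly R[n]}) : Prop :=
  [/\ is_dag P,
      forall x : 'I_n -> R, output x (fun=> 0) P = p.@[x] &
      forall eta : R, 0 < eta < 1 -> exists2 eps : R, 0 < eps < 1 &
        forall (x : 'I_n -> R) (delta : 'I_N -> R),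
          (forall i, `|delta i| <= eps) ->
          `|output x delta P - p.@[x]| <= eta * `|p.@[x]| ].

End Algorithms.

Section Varieties.
Variables (R : realType) (n : nat).
Notation point := ('I_n -> R).

Definition variety (p : {mpoly R[n]}) : set point := [set x | p.@[x] = 0].

Definition allowable_hyperplane (H : set point) : Prop :=
  [\/ exists i, H = [set x | x i = 0],
      exists i j, i != j /\ H = [set x | x i + x j = 0] |
      exists i j, i != j /\ H = [set x | x i - x j = 0] ].

Definition allowable (V : set point) : Prop :=
  exists2 F : set (set (set point)),
    (forall G, F G -> G `<=` allowable_hyperplane) &
    V = \bigcup_(G in F) \bigcap_(H in G) H.

Definition zariski_closed (A : set point) : Prop :=
  exists Q : set {mpoly R[n]}, A = \bigcap_(q in Q) variety q.

Definition irreducible (A : set point) : Prop :=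
  [/\ zariski_closed A, A !=set0 &
      forall B1 B2, zariski_closed B1 -> zariski_closed B2 ->
        A `<=` B1 `|` B2 -> A `<=` B1 \/ A `<=` B2].

Definition irreducible_component (A V : set point) : Prop :=
  [/\ irreducible A, A `<=` V &
      forall B, irreducible B -> B `<=` V -> A `<=` B -> B = A].

End Varieties.

(* An intersection of allowable hyperplanes, given by its zero group and its
   chains, together with a representative of each chain. The chain of i is
   { r | rep r = rep i }, singletons being the variables in no chain, and the
   chain relations read x_r = sigma_r x_(rep r), where sgn r stands for
   sigma_r = -1. *)
Record chains (n : nat) := Chains {
  zgrp : {set 'I_n};
  rep : 'I_n -> 'I_n;
  sgn : 'I_n -> bool;
  rep_idem : forall i, rep (rep i) = rep i;
  sgn_rep : forall i, sgn (rep i) = false;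
  zgrp_singleton : forall i, rep i != i -> (i \notin zgrp) && (rep i \notin zgrp)
}.

Section Changes.
Variable n : nat.
Implicit Types S C : chains n.

Definition locus (R : realType) S : set ('I_n -> R) :=
  [set x | (forall i, i \in zgrp S -> x i = 0) /\
           (forall i, x i = signed (sgn S i) (x (rep S i)))].
Arguments locus : clear implicits.

Definition new_coord (A : zmodType) C (x : 'I_n -> A) (i : 'I_n) : A :=
  if rep C i == i then x i else x i - signed (sgn C i) (x (rep C i)).

Definition old_coord (A : zmodType) C (y : 'I_n -> A) (i : 'I_n) : A :=
  if rep C i == i then y i else y i + signed (sgn C i) (y (rep C i)).

Definition index_set S : {set 'I_n} := zgrp S :|: [set i | rep S i != i].

(* C describes the allowable set that contains S; the change is new_coord C. *)
Definition standard_change (R : realType) S C : Prop :=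
  locus R S `<=` locus R C /\
  @new_coord R C @` locus R S =
    [set y : 'I_n -> R | forall i, i \in index_set S -> y i = 0].

End Changes.

Arguments locus {n} R S _ : rename.

(* R^k with k = #|I| and its dual are identified with the vectors indexed by
   'I_n that vanish off I; likewise for the multi-indices in Z_{>=0}^k.
   Lambda is [exponents p S C], a sequence Lj stands for the set Lambda_j and
   S_{Lambda_j} is [exponent_cone I Lambda Lj]. *)

Section Dominant.
Variables (R : realType) (n : nat).
Implicit Types (p : {mpoly R[n]}) (S C : chains n) (I : {set 'I_n}).
Implicit Types (L Lj : seq 'X_{1..n}) (eta : 'I_n -> R).

Definition in_new_coords p C : {mpoly R[n]} :=
  p \mPo [tuple old_coord C (fun j => 'X_j) i | i < n].

Definition in_old_coords p C : {mpoly R[n]} :=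
  p \mPo [tuple new_coord C (fun j => 'X_j) i | i < n].

Definition restrict I (m : 'X_{1..n}) : 'X_{1..n} :=
  [multinom (if i \in I then m i else 0%N) | i < n].

Definition exponents p S C : seq 'X_{1..n} :=
  undup [seq restrict (index_set S) m | m <- msupp (in_new_coords p C)].

Definition dominant_term p S C Lj : {mpoly R[n]} :=
  let q := in_new_coords p C in
  in_old_coords (\sum_(m <- msupp q | restrict (index_set S) m \in Lj)
                    q@_m *: 'X_[m]) C.

Definition vec (l : 'X_{1..n}) : 'I_n -> R := fun i => (l i)%:R.

Definition pairing eta (y : 'I_n -> R) : R := \sum_i eta i * y i.

Definition covector I : set ('I_n -> R) :=
  [set eta | forall i, i \notin I -> eta i = 0].

Definition covector_nneg I : set ('I_n -> R) :=
  [set eta | covector I eta /\ forall i, 0 <= eta i].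

Definition hull L : set ('I_n -> R) :=
  [set y | exists w : 'X_{1..n} -> R,
     [/\ forall l, l \in L -> 0 <= w l,
         \sum_(l <- L) w l = 1 &
         forall i, y i = \sum_(l <- L) w l * vec l i]].

Definition argmax (P : set ('I_n -> R)) eta : set ('I_n -> R) :=
  [set x | P x /\ forall y, P y -> pairing eta y <= pairing eta x].

(* Nonempty faces, the polytope itself (eta = 0) being one of them. *)
Definition face I (P F : set ('I_n -> R)) : Prop :=
  F !=set0 /\ exists2 eta, covector I eta & F = argmax P eta.

Definition normal_cone I (P F : set ('I_n -> R)) : set ('I_n -> R) :=
  [set eta | covector I eta /\ F `<=` argmax P eta].

Definition dominant_exponents I L Lj : Prop :=
  exists F : set ('I_n -> R),
    [/\ face I (hull L) F,
        forall l, l \in Lj <-> l \in L /\ F (vec l) &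
        exists eta, [/\ covector_nneg I eta, exists i, eta i != 0 &
                        normal_cone I (hull L) F (fun i => - eta i)]].

Definition exponent_cone I L Lj : set ('I_n -> R) :=
  [set eta | [/\ covector_nneg I eta,
     forall l1 l2, l1 \in Lj -> l2 \in Lj ->
       pairing eta (vec l1) = pairing eta (vec l2) &
     forall l1 l, l1 \in Lj -> l \in L -> l \notin Lj ->
       pairing eta (vec l1) < pairing eta (vec l)]].

Definition conditionE I L Lj C : Prop :=
  forall eta, exponent_cone I L Lj eta -> forall r, eta (rep C r) <= eta r.

End Dominant.

(* Polynomials in t with nonnegative real exponents: the monoid algebra of
   the additive monoid of nonnegative reals, written multiplicatively. *)
Section Exponents.
Variable R : realType.

Definition texp := {e : R | 0 <= e}.
HB.instance Definition _ := Choice.on texp.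

Definition texp0 : texp := exist _ 0 (lexx 0).
Definition texpD (a b : texp) : texp :=
  exist _ (val a + val b) (addr_ge0 (valP a) (valP b)).

Fact texpA : associative texpD.
Proof. by move=> a b c; apply: val_inj; rewrite /= addrA. Qed.
Fact texp0D : left_id texp0 texpD.
Proof. by move=> a; apply: val_inj; rewrite /= add0r. Qed.
Fact texpD0 : right_id texp0 texpD.
Proof. by move=> a; apply: val_inj; rewrite /= addr0. Qed.
Fact texp_unit (a b : texp) : texpD a b = texp0 -> a = texp0 /\ b = texp0.
Proof.
move/(congr1 val) => /= /eqP; rewrite paddr_eq0 ?(valP a) ?(valP b) //.
by case/andP=> /eqP a0 /eqP b0; split; apply: val_inj.
Qed.
Fact texpC : commutative texpD.
Proof. by move=> a b; apply: val_inj; rewrite /= addrC. Qed.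

HB.instance Definition _ :=
  Choice_isMonomialDef.Build texp texpA texp0D texpD0 texp_unit.
HB.instance Definition _ :=
  MonomialDef_isConomialDef.Build texp texpC.

End Exponents.

Section TPolynomials.
Variables (R : realType) (A : comNzRingType).
Implicit Type P : {malg A[texp R]}.
Local Open Scope ereal_scope.

(* Degree of the lowest-degree term; +oo for the zero polynomial. *)
Definition lowdeg P : \bar R :=
  \big[Order.min/+oo]_(e <- monalg.msupp P) (val e)%:E.

Definition lowterm P : {malg A[texp R]} :=
  (\sum_(e <- monalg.msupp P | (val e)%:E == lowdeg P)
     << monalg.mcoeff e P *g e >>)%R.

Definition lowdeg2 P : \bar R := lowdeg (P - lowterm P)%R.

End TPolynomials.

Section Pruning.
Variables (R : realType) (n N : nat) (C : chains n) (eta : 'I_n -> R).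
Implicit Types (e : edge n N) (g : gate n N).

(* Polynomials in t whose coefficients are polynomials in the n letters of
   the curve and the N rounding error variables. *)
Notation tpoly := {malg {mpoly R[n + N]}[texp R]}.

(* t^(n_i) x_i; insubd is the inclusion of the nonnegative reals. *)
Definition letter (i : 'I_n) : tpoly :=
  << 'X_(lshift N i) *g insubd (texp0 R) (eta i) >>.

Definition curve : 'I_n -> tpoly := old_coord C letter.

Definition tdelta (i : 'I_N) : tpoly := << 'X_(rshift n i) *g texp0 R >>.

(* If n_r = n_rep, then the lowest-degree term of x_r(t) is
   t^(n_r) (x_r + sigma_r x_rep), which in the original coordinates is the
   source itself: the source already carries it and must not be replaced by
   sigma_r x_rep. *)
Definition redirect e : edge n N :=
  match org e with
  | inl r => if eta (rep C r) < eta r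
             then Edge (neg e (+) sgn C r) (inl (rep C r)) else e
  | inr _ => e
  end.

Definition redirect_both g : gate n N :=
  Gate (gname g) (gop g) (redirect (lhs g)) (redirect (rhs g)).

(* What becomes of a node: kept, possibly with redirected inputs, or deleted,
   its out-edges then starting at the other end of the given edge. *)
Variant fate := Keep of gate n N | Delete of edge n N.

(* g has processed inputs, whose polynomials are read in env. *)
Definition process (env : 'I_N -> tpoly) g : fate :=
  if gop g is Mul then Keep (redirect_both g) else
  let u := edge_val curve env (lhs g) in
  let v := signed (is_sub (gop g)) (edge_val curve env (rhs g)) in
  if (lowdeg v < lowdeg u)%E then
    Delete (Edge (is_sub (gop g) (+) neg (rhs g)) (org (rhs g)))
  else if (lowdeg u < lowdeg v)%E then Delete (lhs g)
  else if [&& is_source (lhs g), is_source (rhs g) & lowterm u + lowterm v == 0]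
  then
    let du := lowdeg2 u in
    let dv := lowdeg2 v in
    if [|| du == +oo%E, dv == +oo%E | du == dv] then Keep g
    else if (du < dv)%E
         then Keep (Gate (gname g) (gop g) (lhs g) (redirect (rhs g)))
         else Keep (Gate (gname g) (gop g) (redirect (lhs g)) (rhs g))
  else Keep (redirect_both g).

(* subst maps the name of a deleted node to the edge that takes its place. *)
Definition resolve (subst : 'I_N -> edge n N) e : edge n N :=
  match org e with
  | inl _ => e
  | inr i => Edge (neg e (+) neg (subst i)) (org (subst i))
  end.

Fixpoint prune_gates (env : 'I_N -> tpoly) (subst : 'I_N -> edge n N)
    (gs : seq (gate n N)) : seq (gate n N) * ('I_N -> edge n N) :=
  if gs is g :: gs' then
    let h := Gate (gname g) (gop g)
                  (resolve subst (lhs g)) (resolve subst (rhs g)) in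
    match process env h with
    | Keep k =>
        let r := prune_gates
          (upd env (gname g) (gate_val curve tdelta env k)) subst gs' in
        (k :: r.1, r.2)
    | Delete e => prune_gates env (upd subst (gname g) e) gs'
    end
  else ([::], subst).

Definition origins e : {set 'I_N} :=
  if org e is inr i then [set i]%SET else finset.set0.

(* The nodes on a path to one of the nodes in the second component of the
   result; the list is in topological order. *)
Definition live_gates (gs : seq (gate n N)) (o : edge n N) :
    seq (gate n N) * {set 'I_N} :=
  foldr (fun g (acc : seq (gate n N) * {set 'I_N}) =>
    if gname g \in acc.2
    then (g :: acc.1, acc.2 :|: origins (lhs g) :|: origins (rhs g))%SET
    else acc) ([::], origins o) gs.

Definition prune (P : algorithm n N) : algorithm n N :=
  let r := prune_gates (fun=> 0) (fun i => Edge false (inr i)) (gates P) in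
  let o := resolve r.2 (out P) in
  Algorithm (live_gates r.1 o).1 o.

End Pruning.

(* Main.v *)
From HB Require Import structures.
From mathcomp Require Import all_boot all_order all_algebra.
From mathcomp Require Import finmap monalg.
Require Import Defs.
From mathcomp Require Import mpoly.
From mathcomp Require Import boolp classical_sets reals constructive_ereal sequences exp.

(** Along the curve [x(t)], whose new coordinates are [t ^ n_i x_i], the
    polynomial [p] equals [t ^ e p_dom + o(t ^ e)], with [e] the common value of
    [eta] on [Lambda_j]. The original algorithm, run on this curve with formal
    rounding errors, returns a polynomial [V] in [t]. As [t] tends to zero,
    accuracy forces the lowest-degree term of [V] to have degree [e] too
    ([output_lowest]), and its coefficient approximates [p_dom] with the same
    relative error ([output_lead_close]). It remains to see that the pruned
    algorithm computes this coefficient.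

    For that, each original node with value [V] on the curve is compared with
    the wire that replaces it, with value [W]. The degree of [W] may be larger
    than that of [V]: if [l + h] with [deg l < deg h] is replaced by [l], then a
    later difference [(l + h) (1 + delta) - l] has the term [delta l], whereas
    its replacement vanishes. The invariant [tracks] allows for this: up to the
    degree of [V] included, [W] agrees with [V] once the rounding errors of the
    deleted nodes are set to zero. Products preserve it because the coefficients
    form an integral domain ([tracksM]). Sums preserve it as long as the
    lowest-degree terms of the original values do not cancel ([tracksD],
    [tracks_drop]). They cannot cancel for two different nodes: the later value
    has the factor [1 + delta_l], and [delta_l] does not occur in the earlier
    one ([edge_sum_inputs]). They do cancel when a node is subtracted from
    itself, where both sides vanish, and for certain pairs of sources, which is
    the case that the second-lowest terms settle ([sum_source_cancel]).

    Computational nodes of the pruned algorithm are moreover homogeneous in [t],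
    since redirection cuts a source down to its lowest-degree term
    ([source_form]). If the output wire starts at such a node, then its value on
    the curve is the wanted coefficient times [t ^ e], and [t = 1] is the
    evaluation of the pruned algorithm at the original point. If it starts at a
    source with two terms, then [p] would be linear with [V(p)] a hyperplane,
    which the position of the component rules out
    ([dominant_not_representative]). *)

Set Implicit Arguments.
Unset Strict Implicit.
Unset Printing Implicit Defensive.

Import Order.TTheory GRing.Theory Num.Theory.

(* The braces are taken back from the monomial algebras, for multinomials. *)
Notation "{ 'mpoly' T [ n ] }" := (mpoly.mpoly n T) : type_scope.
Notation cf := monalg.mcoeff.

Local Open Scope ring_scope.

(** * Lowest-degree terms *)

Section LowestTerms.
Variables (R : realType) (A : comNzRingType).
Implicit Types (T U V : {malg A[texp R]}) (a b : A) (e u v : texp R).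
Notation mono a v := (<< a *g v >> : {malg A[texp R]}).

Definition vanishes_below T v := forall e, val e < val v -> cf e T = 0.

Definition lowest T v := cf v T != 0 /\ vanishes_below T v.

Lemma lowest_exists T : T != 0 -> exists v, lowest T v.
Proof.
have seq_min (s : seq (texp R)) : s != [::] ->
    exists2 v, v \in s & forall e, e \in s -> val v <= val e.
  elim: s => // x [|y s] IHs _.
    by exists x; rewrite ?inE // => e; rewrite inE => /eqP->.
  have [//|v vs vmin] := IHs.
  case: (leP (val x) (val v)) => xv.
    exists x; rewrite ?inE ?eqxx // => e; rewrite inE => /orP[/eqP->//|/vmin].
    exact: le_trans.
  exists v; first by rewrite inE vs orbT.
  by move=> e; rewrite inE => /orP[/eqP->|/vmin//]; apply: ltW.
move=> T0; have [|v vT vmin] := seq_min (monalg.msupp T).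
  by apply: contraNneq T0 => T0; rewrite (monalg.monalgE T) T0 big_nil.
exists v; split; first by rewrite monalg.mcoeff_neq0.
move=> e ev; apply/eqP; rewrite monalg.mcoeff_eq0; apply/negP => /vmin.
by rewrite leNgt ev.
Qed.

Lemma lowdeg0 : lowdeg (0 : {malg A[texp R]}) = +oo%E.
Proof. by rewrite /lowdeg monalg.msupp0 big_nil. Qed.

Lemma lowest_lowdeg T v : lowest T v -> lowdeg T = (val v)%:E.
Proof.
move=> [vT Tbelow]; apply/le_anti/andP; split.
  by apply: (@bigmin_inf_seq _ _ _ _ _ v xpredT); rewrite -?monalg.mcoeff_neq0.
rewrite /lowdeg big_seq; elim/big_ind: _ => //.
- by rewrite leey.
- by move=> x y; rewrite le_min => -> ->.
move=> e; rewrite -monalg.mcoeff_neq0 lee_fin leNgt.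
by apply: contra => /Tbelow ->.
Qed.

Lemma lowdegN T : lowdeg (- T) = lowdeg T.
Proof.
have [->|/lowest_exists[v vT]] := eqVneq T 0; first by rewrite oppr0.
rewrite (lowest_lowdeg vT); apply: lowest_lowdeg; case: vT => vT Tbelow.
by split=> [|e ev]; rewrite monalg.mcoeffN ?oppr_eq0 // Tbelow ?oppr0.
Qed.

Lemma lowterm0 : lowterm (0 : {malg A[texp R]}) = 0.
Proof. by rewrite /lowterm monalg.msupp0 big_nil. Qed.

Lemma lowterm_lowest T v : lowest T v -> lowterm T = << cf v T *g v >>.
Proof.
move=> vT; rewrite /lowterm (lowest_lowdeg vT).
under eq_bigl => e do rewrite eqe.
rewrite -big_filter (perm_big [:: v]) ?big_seq1 //.
apply: uniq_perm => [||e]; rewrite ?filter_uniq ?fset_uniq // mem_filter inE.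
apply/andP/eqP => [[/eqP/val_inj->]//|->]; split=> //.
by rewrite -monalg.mcoeff_neq0; case: vT.
Qed.

Lemma lowest_mono a v : a != 0 -> lowest (mono a v) v.
Proof.
move=> a0; split=> [|e ev]; rewrite monalg.mcoeffU ?eqxx ?mulr1n //.
by case: eqP ev => [->|]; rewrite ?ltxx.
Qed.

Lemma val_lt_neq u v : val u < val v -> (v == u) = false.
Proof. by apply: contraTF => /eqP->; rewrite ltxx. Qed.

Lemma coeff_two a u b v : val u < val v ->
  cf u (mono a u + mono b v) = a.
Proof.
by move=> /val_lt_neq vu; rewrite monalg.mcoeffD 2!monalg.mcoeffU eqxx vu addr0.
Qed.

Lemma coeff_two_le a u b v e : val u < val v -> val e <= val u ->
  cf e (mono a u + mono b v) = cf e (mono a u).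
Proof.
move=> uv eu; rewrite monalg.mcoeffD [cf e (mono b v)]monalg.mcoeffU.
by rewrite (val_lt_neq (le_lt_trans eu uv)) addr0.
Qed.

Lemma lowest_two a u b v : a != 0 -> val u < val v ->
  lowest (mono a u + mono b v) u.
Proof.
move=> a0 uv; split=> [|e eu]; first by rewrite coeff_two.
rewrite monalg.mcoeffD 2!monalg.mcoeffU (val_lt_neq eu).
by rewrite (val_lt_neq (lt_trans eu uv)) addr0.
Qed.

Lemma lowdeg_mono a v : a != 0 -> lowdeg (mono a v) = (val v)%:E.
Proof. by move=> a0; apply/lowest_lowdeg/lowest_mono. Qed.

Lemma lowterm_mono a v : lowterm (mono a v) =  (mono a v).
Proof.
have [->|a0] := eqVneq a 0; first by rewrite monalg.monalgU0 lowterm0.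
by rewrite (lowterm_lowest (lowest_mono _ a0)) monalg.mcoeffUU.
Qed.

Lemma lowdeg2_mono a v : lowdeg2 (mono a v) = +oo%E.
Proof. by rewrite /lowdeg2 lowterm_mono subrr lowdeg0. Qed.

Lemma lowterm_two a u b v : a != 0 -> val u < val v ->
  lowterm (mono a u + mono b v) =  (mono a u).
Proof.
by move=> a0 uv; rewrite (lowterm_lowest (lowest_two b a0 uv)) coeff_two.
Qed.

Lemma lowdeg2_two a u b v : a != 0 -> b != 0 -> val u < val v ->
  lowdeg2 (mono a u + mono b v) = (val v)%:E.
Proof.
move=> a0 b0 uv.
by rewrite /lowdeg2 lowterm_two // addrC addKr lowdeg_mono.
Qed.

Lemma lowest_mul_coeff T U u v : vanishes_below T u -> vanishes_below U v ->
  cf (monalg.mmul u v) (T * U) = cf u T * cf v U.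
Proof.
move=> Tu Uv; pose d (W : {malg A[texp R]}) w := (w |` monalg.msupp W)%fset.
have dS W w : (monalg.msupp W `<=` d W w)%fset by apply: fsubsetU1.
rewrite (monalg.mcoeffMlw _ (dS T u) (dS U v)).
rewrite (bigD1_seq u) ?fset_uniq ?fset1U1 //= (bigD1_seq v) ?fset_uniq ?fset1U1 //=.
rewrite eqxx mulr1n big1_seq ?addr0 => [|k /andP[kv _]]; last first.
  case: eqP => //= /(congr1 val) /= /addrI /val_inj kv'.
  by rewrite kv' eqxx in kv.
rewrite big1_seq ?addr0 // => k /andP[ku _]; rewrite big1_seq // => l _.
case: eqP => //= /(congr1 val) /= kl.
case: (ltP (val k) (val u)) => [/Tu->|uk]; first by rewrite mul0r.
case: (ltP (val l) (val v)) => [/Uv->|vl]; first by rewrite mulr0.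
have /val_inj ku' : val k = val u.
  apply/le_anti; rewrite uk andbT -(lerD2r (val l)) kl lerD2l.
  exact: vl.
by rewrite ku' eqxx in ku.
Qed.

Lemma vanishes_below_mul T U u v : vanishes_below T u -> vanishes_below U v ->
  vanishes_below (T * U) (monalg.mmul u v).
Proof.
move=> Tu Uv e euv; rewrite monalg.mcoeffMl big1_seq // => k _.
rewrite big1_seq // => l _; case: eqP => //= /(congr1 val) /= kl.
case: (ltP (val k) (val u)) => [/Tu->|uk]; first by rewrite mul0r.
case: (ltP (val l) (val v)) => [/Uv->|vl]; first by rewrite mulr0.
by move: euv; rewrite ltNge -[val e]kl lerD.
Qed.

Lemma vanishes_below_le T u v :
  vanishes_below T v -> val u <= val v -> vanishes_below T u.
Proof. by move=> Tv uv e eu; apply: Tv; apply: lt_le_trans uv. Qed.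

Lemma vanishes_below_add T U v :
  vanishes_below T v -> vanishes_below U v -> vanishes_below (T + U) v.
Proof. by move=> Tv Uv e ev; rewrite monalg.mcoeffD Tv // Uv // addr0. Qed.

Lemma lowdeg_lt T U v : vanishes_below T v -> (lowdeg T < lowdeg U)%E ->
  vanishes_below U v /\ cf v U = 0.
Proof.
move=> Tv.
have [->|/lowest_exists[u Uu]] := eqVneq U 0.
  by move=> _; split=> [e _|]; rewrite monalg.mcoeff0.
have [->|/lowest_exists[t Tt]] := eqVneq T 0; first by rewrite lowdeg0 ltNge leey.
rewrite (lowest_lowdeg Uu) (lowest_lowdeg Tt) lte_fin => tu.
have vu : val v < val u.
  apply: le_lt_trans tu; rewrite leNgt; apply: contraTN isT => tv.
  by case: Tt; rewrite Tv // eqxx.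
by case: Uu => _ Ub; split; [apply: vanishes_below_le Ub (ltW vu)|apply: Ub].
Qed.

End LowestTerms.

(** * Points where a multinomial does not vanish *)

Section NonVanishing.
Variable R : realType.

Lemma digits_inj (B : nat) (f g : nat -> nat) n :
  (forall i, f i < B)%N -> (forall i, g i < B)%N ->
  (\sum_(i < n) f i * B ^ i = \sum_(i < n) g i * B ^ i)%N ->
  forall i, (i < n)%N -> f i = g i.
Proof.
elim: n f g => // n IHn f g fB gB.
have B0 : (0 < B)%N by apply: leq_ltn_trans (fB 0%N).
rewrite !big_ord_recl /= !expn0 !muln1.
have shift h : (\sum_(i < n) h (bump 0 i) * B ^ bump 0 i =
                (\sum_(i < n) h i.+1 * B ^ i) * B)%N.
  by rewrite big_distrl; apply: eq_bigr => i _; rewrite /bump add1n expnSr mulnA.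
rewrite !shift => E; have E0 : f 0%N = g 0%N.
  by move: (congr1 (modn^~ B) E); rewrite ![(_ + _ * B)%N]addnC !modnMDl !modn_small.
have ES : (\sum_(i < n) f i.+1 * B ^ i = \sum_(i < n) g i.+1 * B ^ i)%N.
  by move/eqP: E; rewrite E0 eqn_add2l eqn_pmul2r // => /eqP.
by case=> [_|i]; [exact: E0 | exact: (IHn (fun i => f i.+1) (fun i => g i.+1))].
Qed.

Lemma poly_nonroot (q : {poly R}) (eps : R) : q != 0 -> 0 < eps ->
  exists2 s, 0 < s <= eps & ~~ root q s.
Proof.
move=> q0 eps0; pose c k : R := eps / k.+1%:R.
have c_inj : injective c.
  move=> i j /(mulfI (lt0r_neq0 eps0)) /invr_inj /eqP.
  by rewrite eqr_nat => /eqP[].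
have [/hasP[s /mapP[k _ ->] ks]|/hasPn no] :=
    boolP (has (fun s => ~~ root q s) [seq c k | k <- iota 0 (size q)]).
  exists (c k) => //; rewrite divr_gt0 ?ltr0Sn //=.
  by rewrite ler_pdivrMr ?ltr0Sn // ler_peMr ?ler1n // ltW.
suff: (size q < size q)%N by rewrite ltnn.
have {1}-> : size q = size [seq c k | k <- iota 0 (size q)].
  by rewrite size_map size_iota.
apply: max_poly_roots => //; last by rewrite map_inj_uniq ?iota_uniq.
by apply/allP => s /no; rewrite negbK.
Qed.

(** Kronecker's substitution: distinct monomials of degree less than [B] take
    distinct powers of [s] at the point [x_i = s ^ (B ^ i)], so that a nonzero
    multinomial becomes a nonzero polynomial in [s]. *)
Lemma mpoly_nonvanishing n (p : {mpoly R[n]}) (eps : R) : p != 0 -> 0 < eps ->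
  exists2 y : 'I_n -> R, (forall i, `|y i| <= eps) & p.@[y] != 0.
Proof.
move=> p0 eps0; pose B := (msize p).+1.
pose k (m : 'X_{1..n}) := (\sum_(i < n) m i * B ^ i)%N.
have k_inj : {in msupp p &, injective k}.
  move=> m m' /msize_mdeg_lt mB /msize_mdeg_lt m'B kk; apply/mnmP => i.
  pose f (m : 'X_{1..n}) j := if insub j is Some i then m i else 0%N.
  have fE (q : 'X_{1..n}) (j : 'I_n) : f q j = q j.
    by rewrite /f insubT //= => ?; congr (q _); apply: val_inj.
  have fB (q : 'X_{1..n}) : (mdeg q < msize p)%N -> forall j, (f q j < B)%N.
    move=> qB j; rewrite /f; case: insub => // l; rewrite ltnS.
    apply: leq_trans (ltnW qB); rewrite mdegE (bigD1 l) //= leq_addr //.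
  rewrite -!fE; apply: (digits_inj (n := n) (fB _ mB) (fB _ m'B)) => //.
  by under eq_bigr do rewrite fE; under [RHS]eq_bigr do rewrite fE.
pose q : {poly R} := \sum_(m <- msupp p) p@_m *: 'X^(k m).
have q0 : q != 0.
  have := mlead_supp p0; set m := mlead p => mp.
  apply/eqP => /(congr1 (fun q : {poly R} => q`_(k m))).
  rewrite coef_sum coef0 (bigD1_seq m) ?msupp_uniq //= coefZ coefXn eqxx mulr1.
  rewrite big_seq_cond big1 ?addr0 => [|m' /andP[m'p m'm]].
    by apply/eqP; rewrite -mcoeff_msupp.
  rewrite coefZ coefXn; case: eqP => [/k_inj mm|_]; last by rewrite mulr0.
  by rewrite mm ?eqxx in m'm.
have [||s /andP[s0 s1] qs] := @poly_nonroot q (Num.min eps 1) => //.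
  by rewrite lt_min eps0 ltr01.
exists (fun i => s ^+ (B ^ i)).
  move=> i; rewrite ger0_norm; last by rewrite exprn_ge0 // ltW.
  move: s1; rewrite le_min => /andP[se s1]; apply: le_trans se.
  rewrite -[leRHS]expr1; apply: ler_wiXn2l; rewrite ?expn_gt0 // ltW //.
apply: contra qs; rewrite rootE => /eqP p_eq; rewrite -p_eq.
rewrite mevalE horner_sum; apply/eqP/eq_bigr => m _.
rewrite hornerZ hornerXn /k; congr (_ * _).
rewrite (big_morph _ (exprD s) (expr0 s)); apply: eq_bigr => i _.
by rewrite mulnC exprM.
Qed.

Lemma mpoly_eq n (p q : {mpoly R[n]}) : (forall y, p.@[y] = q.@[y]) -> p = q.
Proof.
move=> pq; apply/eqP; rewrite -subr_eq0; apply/negPn/negP => pq0.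
have [y _] := mpoly_nonvanishing pq0 ltr01.
by rewrite mevalB pq subrr eqxx.
Qed.

End NonVanishing.

(** * Letting the parameter tend to zero *)

Section Evaluation.
Variables (R : realType) (m : nat).
Notation tpoly := {malg {mpoly R[m]}[texp R]}.
Implicit Types (T F G : tpoly) (y : 'I_m -> R) (s : R).

(** The power [t ^ e] at the parameter [t = exp s]: a limit at [t = 0] becomes
    one at [s = - oo], and [t = 1] is [s = 0]. *)
Definition exp_power s (e : texp R) : R := expR (s * val e).

Fact exp_power_morph s : monalg.mmorphism (exp_power s).
Proof.
by split=> [u v|]; rewrite /exp_power /= ?mulr0 ?expR0 // mulrDr expRD.
Qed.
HB.instance Definition _ s :=
  monalg.isMultiplicative.Build (texp R) R (exp_power s) (exp_power_morph s).

Definition evalt y s T : R := monalg.mmap (meval y) (exp_power s) T.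

HB.instance Definition _ y s := GRing.RMorphism.copy (evalt y s)
  (monalg.mmap (meval y) (exp_power s)).

Lemma evalt_mono y s a e : evalt y s << a *g e >> = a.@[y] * expR (s * val e).
Proof. by rewrite /evalt monalg.mmapU. Qed.

Lemma evalt_lowest y T v M : 0 < M ->
  (forall e, val e < val v -> (cf e T).@[y] = 0) ->
  `|expR (M * val v) * evalt y (- M) T - (cf v T).@[y]| <=
    (\sum_(e <- monalg.msupp T | e != v) `|(cf e T).@[y]| / `|val e - val v|) / M.
Proof.
move=> M0 Tv; set s := monalg.msupp T.
have rest_bound e : e != v ->
    `|(cf e T).@[y] * expR (M * (val v - val e))| <=
      `|(cf e T).@[y]| / `|val e - val v| / M.
  move=> ev; rewrite normrM (ger0_norm (expR_ge0 _)).
  case: (ltgtP (val e) (val v)) => [/Tv->|ve|/val_inj /eqP]; last by rewrite (negPf ev).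
    by rewrite normr0 !mul0r.
  rewrite -mulrA ler_wpM2l // -opprB mulrN expRN -invfM.
  have g0 : 0 < val e - val v by rewrite subr_gt0.
  rewrite (gtr0_norm g0) mulrC lef_pV2 ?posrE ?expR_gt0 ?mulr_gt0 //.
  apply: le_trans (expR_ge1Dx _); rewrite mulrC lerDr //.
have -> : expR (M * val v) * evalt y (- M) T - (cf v T).@[y] =
    \sum_(e <- s | e != v) (cf e T).@[y] * expR (M * (val v - val e)).
  have vs : (s `<=` v |` s)%fset by apply: fsubsetU1.
  rewrite /evalt (monalg.mmapEw vs) mulr_sumr.
  have termE e : expR (M * val v) * ((cf e T).@[y] * exp_power (- M) e) =
      (cf e T).@[y] * expR (M * (val v - val e)).
    by rewrite mulrCA /exp_power -expRD mulNr mulrBr.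
  under eq_bigr do rewrite termE.
  rewrite (bigD1_seq v) ?fset_uniq ?fset1U1 //= subrr mulr0 expR0 mulr1 addrC addrK.
  rewrite -[LHS]big_filter -[RHS]big_filter; apply: perm_big.
  apply: uniq_perm; rewrite ?filter_uniq ?fset_uniq // => e.
  by rewrite !mem_filter !inE; case: eqP.
rewrite mulr_suml; apply: le_trans (ler_norm_sum _ _ _) _.
by apply: ler_sum => e; apply: rest_bound.
Qed.

(** Comparison of leading coefficients: multiply by [t ^ (- v)] and let [t] tend
    to zero. *)
Lemma evalt_dominated y K F G v : 0 <= K ->
  (forall s, s <= 0 -> `|evalt y s F| <= K * `|evalt y s G|) ->
  (forall e, val e < val v -> (cf e F).@[y] = 0) ->
  (forall e, val e < val v -> (cf e G).@[y] = 0) ->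
  `|(cf v F).@[y]| <= K * `|(cf v G).@[y]|.
Proof.
move=> K0 FG Fv Gv; rewrite leNgt -subr_gt0; apply/negP.
set D := _ - _ => D0.
set a := (\sum_(e <- monalg.msupp F | e != v) `|(cf e F).@[y]| / `|val e - val v|).
set b := (\sum_(e <- monalg.msupp G | e != v) `|(cf e G).@[y]| / `|val e - val v|).
have a0 : 0 <= a by apply: sumr_ge0 => e _; rewrite divr_ge0.
have b0 : 0 <= b by apply: sumr_ge0 => e _; rewrite divr_ge0.
have c0 : 0 < a + K * b + 1 by rewrite ltr_pwDr // addr_ge0 // mulr_ge0.
(* At the parameter [exp (- M)] the remainders contribute at most
   [(a + K * b) / M], which is less than [D]. *)
pose M := (a + K * b + 1) / D.
have M0 : 0 < M by rewrite divr_gt0.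
have := evalt_lowest M0 Fv; have := evalt_lowest M0 Gv; rewrite -/a -/b.
have := FG (- M); rewrite oppr_le0 => /(_ (ltW M0)).
rewrite -(ler_pM2l (expR_gt0 (M * val v))) mulrCA.
have nE z : expR (M * val v) * `|z| = `|expR (M * val v) * z|.
  by rewrite normrM (ger0_norm (expR_ge0 _)).
rewrite 2!nE.
set f := _ * evalt _ _ F; set g := _ * evalt _ _ G => fg gG fF.
suff: D <= (a + K * b) / M.
  rewrite ler_pdivlMr // /M mulrCA divff ?lt0r_neq0 // mulr1.
  by rewrite gerDl ler10.
rewrite /D lerBlDr mulrDl -[K * b / M]mulrA.
have Fn : `|(cf v F).@[y]| <= `|f| + a / M.
  rewrite -lerBlDl; apply: le_trans fF; rewrite distrC; apply: lerB_dist.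
have Gn : `|g| <= `|(cf v G).@[y]| + b / M.
  by rewrite -lerBlDl; apply: le_trans gG; apply: lerB_dist.
have fK : `|f| <= K * `|(cf v G).@[y]| + K * (b / M).
  by apply: le_trans fg _; rewrite -mulrDr ler_wpM2l.
apply: le_trans Fn _; apply: le_trans (lerD fK (lexx (a / M))) _.
by rewrite [leLHS]addrC [X in _ + X <= _]addrC addrA.
Qed.

End Evaluation.

(** * Tracking lowest-degree terms *)

Section Tracking.
Variables (R : realType) (m : nat).
Notation tpoly := {malg {mpoly R[m]}[texp R]}.
Notation point := ('I_m -> R).
Implicit Types (T U V W : tpoly) (Z : point -> Prop) (v : texp R).

(** [W] stands for [V] as far as lowest-degree terms go: it agrees with [V] up to
    the degree of [V], at the points in [Z]. Nothing is said about the degree of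
    [W], nor about the coefficient of [W] off [Z]. *)
Definition tracks Z V W : Prop :=
  (V = 0 /\ W = 0) \/
  exists v, [/\ lowest V v, vanishes_below W v &
                forall y, Z y -> (cf v V).@[y] = (cf v W).@[y]].

Definition no_cancel V1 V2 : Prop :=
  forall v, lowest V1 v -> lowest V2 v -> cf v V1 + cf v V2 != 0.

Lemma no_cancelC V1 V2 : no_cancel V1 V2 -> no_cancel V2 V1.
Proof. by move=> nc v V2v V1v; rewrite addrC; apply: nc. Qed.

Lemma no_cancel_refl V : no_cancel V V.
Proof.
move=> v [Vv _] _; rewrite -mulr2n; apply: contra Vv => /eqP V2.
apply/eqP/mpoly_eq => y; have /eqP := congr1 (meval y) V2.
by rewrite mevalMn !meval0 mulrn_eq0 => /eqP.
Qed.

Lemma no_cancel_lowdeg V1 V2 : lowdeg V1 != lowdeg V2 -> no_cancel V1 V2.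
Proof.
by move=> + v V1v V2v; rewrite (lowest_lowdeg V1v) (lowest_lowdeg V2v) eqxx.
Qed.

Lemma no_cancel_lowterm V1 V2 : lowterm V1 + lowterm V2 != 0 -> no_cancel V1 V2.
Proof.
move=> + v V1v V2v; rewrite (lowterm_lowest V1v) (lowterm_lowest V2v).
by rewrite -monalg.monalgUD monalg.monalgU_eq0.
Qed.

Lemma tracks_refl Z V : tracks Z V V.
Proof.
have [->|/lowest_exists[v Vv]] := eqVneq V 0; first by left.
by right; exists v; split=> //; case: Vv.
Qed.

Lemma tracks_sub Z Z' V W : (forall y, Z' y -> Z y) -> tracks Z V W -> tracks Z' V W.
Proof.
move=> ZZ [[-> ->]|[v [Vv Wv VW]]]; [by left|right].
by exists v; split=> // y /ZZ; apply: VW.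
Qed.

Lemma lowestN V v : lowest V v -> lowest (- V) v.
Proof.
by case=> Vv Vb; split=> [|e ev]; rewrite monalg.mcoeffN ?oppr_eq0 // Vb ?oppr0.
Qed.

Lemma tracksN Z V W : tracks Z V W -> tracks Z (- V) (- W).
Proof.
case=> [[-> ->]|[v [Vv Wv VW]]]; first by left; rewrite oppr0.
right; exists v; split=> [|e ev|y Zy]; first exact: lowestN.
  by rewrite monalg.mcoeffN Wv ?oppr0.
by rewrite !monalg.mcoeffN !mevalN VW.
Qed.

Lemma tracks_signed Z (s : bool) V W :
  tracks Z V W -> tracks Z (signed s V) (signed s W).
Proof. by case: s => //=; apply: tracksN. Qed.

Lemma lowestD_lt V1 V2 v : lowest V1 v -> vanishes_below V2 v -> cf v V2 = 0 ->
  lowest (V1 + V2) v.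
Proof.
move=> [V1v V1b] V2b V2v; split; last exact: vanishes_below_add.
by rewrite monalg.mcoeffD V2v addr0.
Qed.

Lemma tracksD Z V1 V2 W1 W2 : tracks Z V1 W1 -> tracks Z V2 W2 ->
  no_cancel V1 V2 -> tracks Z (V1 + V2) (W1 + W2).
Proof.
case=> [[-> ->]|[v1 [V1v W1v VW1]]]; first by rewrite !add0r.
case=> [[-> ->]|[v2 [V2v W2v VW2]]].
  by move=> _; rewrite !addr0; right; exists v1.
move=> nc; right; have [V2n V2b] := V2v; have [V1n V1b] := V1v.
case: (ltgtP (val v1) (val v2)) => v12.
- exists v1; split; first by apply: lowestD_lt (V2b _ v12) => //;
    apply: vanishes_below_le (ltW v12).
    by apply: vanishes_below_add => //; apply: vanishes_below_le (ltW v12).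
  by move=> y Zy; rewrite !monalg.mcoeffD (V2b _ v12) (W2v _ v12) !addr0 VW1.
- exists v2; split; first by rewrite addrC; apply: lowestD_lt (V1b _ v12) => //;
    apply: vanishes_below_le (ltW v12).
    by apply: vanishes_below_add => //; apply: vanishes_below_le (ltW v12).
  by move=> y Zy; rewrite !monalg.mcoeffD (V1b _ v12) (W1v _ v12) !add0r VW2.
move: v12 => /val_inj v12; rewrite -{v2}v12 in V2v W2v VW2 V2n V2b *.
exists v1; split; [split|exact: vanishes_below_add|].
- by rewrite monalg.mcoeffD; apply: nc.
- exact: vanishes_below_add.
by move=> y Zy; rewrite !monalg.mcoeffD !mevalD VW1 ?VW2.
Qed.

(** The summand of higher degree may be dropped: it vanishes at the exponents
    where the sum is tracked. *)
Lemma tracks_drop Z V1 V2 W1 W2 : tracks Z V1 W1 -> tracks Z V2 W2 ->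
  no_cancel V1 V2 -> (lowdeg W1 < lowdeg W2)%E -> tracks Z (V1 + V2) W1.
Proof.
move=> tr1 tr2 nc W12; have := tracksD tr1 tr2 nc.
case=> [[_ /eqP]|[v [Vv Wv VW]]].
  by rewrite addr_eq0 => /eqP W1E; rewrite W1E lowdegN ltxx in W12.
have [W10|/lowest_exists[w W1w]] := eqVneq W1 0.
  by move: W12; rewrite W10 lowdeg0 ltNge leey.
have [W1n W1b] := W1w; have [W2b W2w] := lowdeg_lt W1b W12.
have vw : val v <= val w.
  rewrite leNgt; apply: contra W1n => /Wv.
  by rewrite monalg.mcoeffD W2w addr0 => ->.
have W1v := vanishes_below_le W1b vw; right; exists v; split=> // y Zy.
by rewrite VW // monalg.mcoeffD (lowdeg_lt W1v W12).2 addr0.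
Qed.

Lemma tracksM Z V1 V2 W1 W2 : tracks Z V1 W1 -> tracks Z V2 W2 ->
  tracks Z (V1 * V2) (W1 * W2).
Proof.
case=> [[-> ->]|[v1 [[V1v V1b] W1v VW1]]]; first by left; rewrite !mul0r.
case=> [[-> ->]|[v2 [[V2v V2b] W2v VW2]]]; first by left; rewrite !mulr0.
right; exists (monalg.mmul v1 v2); split; [split| |].
- by rewrite lowest_mul_coeff // mulf_neq0.
- exact: vanishes_below_mul.
- exact: vanishes_below_mul.
move=> y Zy; apply: etrans (congr1 (meval y) (lowest_mul_coeff V1b V2b)) _.
apply: etrans _ (esym (congr1 (meval y) (lowest_mul_coeff W1v W2v))).
by rewrite mevalM VW1 // VW2 // -mevalM.
Qed.

Definition independent (k : 'I_m) T : Prop :=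
  forall e (y y' : point), (forall i, i != k -> y i = y' i) ->
    (cf e T).@[y] = (cf e T).@[y'].

Definition killed (k : 'I_m) T : Prop :=
  forall e (y : point), y k = -1 -> (cf e T).@[y] = 0.

(** At a point where the variable [k] is [-1], the second lowest coefficient is
    zero and the first one keeps its value, as this does not depend on [k]. *)
Lemma no_cancel_killed k V1 V2 : independent k V1 -> killed k V2 -> no_cancel V1 V2.
Proof.
move=> V1k V2k v [V1v _] _; apply: contra V1v => /eqP V12.
apply/eqP/mpoly_eq => y; rewrite meval0.
pose y' i := if i == k then -1 else y i.
rewrite (V1k _ y y') => [|i /negPf ik]; last by rewrite /y' ik.
have := congr1 (meval y') V12.
by rewrite mevalD V2k ?addr0 ?meval0 // /y' eqxx.
Qed.

Lemma independentD k T U : independent k T -> independent k U -> independent k (T + U).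
Proof.
by move=> Tk Uk e y y' yy; rewrite monalg.mcoeffD !mevalD (Tk _ _ _ yy) (Uk _ _ _ yy).
Qed.

Lemma independent_signed k (s : bool) T : independent k T -> independent k (signed s T).
Proof.
case: s => //= Tk e y y' yy.
by rewrite monalg.mcoeffN !mevalN (Tk _ _ _ yy).
Qed.

Lemma independentM k T U : independent k T -> independent k U -> independent k (T * U).
Proof.
move=> Tk Uk e y y' yy; rewrite monalg.mcoeffMl !raddf_sum /=.
apply: eq_bigr => u _; rewrite !raddf_sum /=; apply: eq_bigr => v _.
by rewrite !mevalMn !mevalM (Tk _ _ _ yy) (Uk _ _ _ yy).
Qed.

Lemma independent_mono k a v : (forall y y' : point,
    (forall i, i != k -> y i = y' i) -> a.@[y] = a.@[y']) ->
  independent k << a *g v >>.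
Proof.
by move=> ak e y y' yy; rewrite monalg.mcoeffU !mevalMn (ak _ _ yy).
Qed.

Lemma killed_signed k (s : bool) T : killed k T -> killed k (signed s T).
Proof.
by case: s => //= Tk e y yk; rewrite monalg.mcoeffN mevalN Tk ?oppr0.
Qed.

End Tracking.

Section RoundingFactor.
Variables (R : realType) (n N : nat).
Notation tpoly := {malg {mpoly R[n + N]}[texp R]}.
Implicit Types (T : tpoly) (i j : 'I_N).

Lemma rounding_factorE i : 1 + tdelta R n i =
  << 1 + 'X_(rshift n i) *g texp0 R >> :> tpoly.
Proof. by rewrite monalg.monalgUD. Qed.

Lemma rounding_factor_coeff i T e :
  cf e (T * (1 + tdelta R n i)) = cf e T * (1 + 'X_(rshift n i)).
Proof. by rewrite rounding_factorE mulrC monalg.mcoeffCM mulrC. Qed.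

Lemma killed_rounding i T : killed (rshift n i) (T * (1 + tdelta R n i)).
Proof.
move=> e y yi; rewrite rounding_factor_coeff mevalM mevalD meval1 mevalXU yi.
by rewrite subrr mulr0.
Qed.

Lemma independent_rounding i j : i != j ->
  independent (rshift n i) (1 + tdelta R n j).
Proof.
move=> ij; rewrite rounding_factorE; apply: independent_mono => y y' yy.
by rewrite !mevalD !meval1 !mevalXU yy // (inj_eq (@rshift_inj _ _)) eq_sym.
Qed.

Lemma independent_letter eta i (k : 'I_n) :
  independent (rshift n i) (letter N eta k : tpoly).
Proof.
apply: independent_mono => y y' yy.
by rewrite !mevalXU yy // eq_lrshift.
Qed.

(** A deleted node contributes the factor [1] in place of its rounding factor,
    and these agree where its rounding error vanishes. *)
Lemma tracks_rounding_deleted Z i :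
  (forall y : 'I_(n + N) -> R, Z y -> y (rshift n i) = 0) ->
  tracks Z (1 + tdelta R n i) 1.
Proof.
move=> Zi; right; exists (texp0 R); rewrite rounding_factorE; split.
- apply: lowest_mono; apply/eqP => /(congr1 (meval (fun=> 0))).
  by rewrite mevalD meval1 mevalXU addr0 meval0 => /eqP; rewrite oner_eq0.
- by move=> e; rewrite ltNge (valP e).
move=> y Zy; apply: etrans (congr1 (meval y) (monalg.mcoeffUU _ _)) _.
apply: etrans _ (esym (congr1 (meval y) (monalg.mcoeffUU (texp0 R) 1))).
by rewrite mevalD mevalXU Zi // addr0.
Qed.

End RoundingFactor.

(** * Evaluating circuits *)

Section Circuits.
Variables n N : nat.
Implicit Types (e : edge n N) (g : gate n N).

Definition flip (s : bool) e : edge n N := Edge (s (+) neg e) (org e).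

Lemma edge_val_flip (A : nzRingType) (src : 'I_n -> A) env s e :
  edge_val src env (flip s e) = signed s (edge_val src env e).
Proof. by rewrite /edge_val /flip /=; case: s; case: neg => //=; rewrite opprK. Qed.

Lemma gate_val_sum (A : nzRingType) (src : 'I_n -> A) delta env g : gop g <> Mul ->
  gate_val src delta env g =
    (edge_val src env (lhs g) + edge_val src env (flip (is_sub (gop g)) (rhs g)))
      * (1 + delta (gname g)).
Proof. by move=> gM; rewrite edge_val_flip /gate_val; case: (gop g) gM. Qed.

Lemma gate_val_mul (A : nzRingType) (src : 'I_n -> A) delta env g : gop g = Mul ->
  gate_val src delta env g =
    edge_val src env (lhs g) * edge_val src env (rhs g) * (1 + delta (gname g)).
Proof. by rewrite /gate_val => ->. Qed.

Lemma rmorph_edge_val (A B : nzRingType) (f : {rmorphism A -> B}) src src' env env' e :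
  (forall i, f (src i) = src' i) -> (forall i, f (env i) = env' i) ->
  f (edge_val src env e) = edge_val src' env' e.
Proof.
move=> fsrc fenv; rewrite /edge_val.
by case: neg => /=; case: org => i; rewrite ?rmorphN ?fsrc ?fenv.
Qed.

Lemma rmorph_run (A B : nzRingType) (f : {rmorphism A -> B}) src src' delta delta'
    env env' (gs : seq (gate n N)) :
  (forall i, f (src i) = src' i) ->
  (forall j, j \in map (@gname n N) gs -> f (delta j) = delta' j) ->
  (forall i, f (env i) = env' i) ->
  forall i, f (run src delta env gs i) = run src' delta' env' gs i.
Proof.
move=> fsrc; elim: gs env env' => //= g gs IHgs env env' fdelta fenv.
apply: IHgs => [h hgs|j]; first by rewrite fdelta // inE hgs orbT.
rewrite /upd; case: eqP => // _; rewrite /gate_val.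
have fedge e : f (edge_val src env e) = edge_val src' env' e by apply: rmorph_edge_val.
rewrite rmorphM rmorphD rmorph1 fdelta ?mem_head // -!fedge.
by case: (gop g); rewrite ?rmorphM ?rmorphD ?rmorphN.
Qed.

Lemma rmorph_output (A B : nzRingType) (f : {rmorphism A -> B}) src src' delta delta'
    (P : algorithm n N) :
  (forall i, f (src i) = src' i) ->
  (forall j, j \in map (@gname n N) (gates P) -> f (delta j) = delta' j) ->
  f (output src delta P) = output src' delta' P.
Proof.
move=> fsrc fdelta; apply: rmorph_edge_val => // i.
by apply: rmorph_run => [k||k]; rewrite ?rmorph0 ?fsrc.
Qed.

Lemma edge_val_upd (A : nzRingType) (src : 'I_n -> A) env i a seen e :
  i \notin seen -> edge_ok seen e ->
  edge_val src (upd env i a) e = edge_val src env e.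
Proof.
move=> iseen; rewrite /edge_ok /edge_val /upd; case: org => //= j jseen.
by case: eqP jseen => // ->; rewrite (negPf iseen).
Qed.

Lemma edge_ok_sub seen seen' e :
  (forall i, i \in seen -> i \in seen') -> edge_ok seen e -> edge_ok seen' e.
Proof. by move=> ss; rewrite /edge_ok; case: org => // i; apply: ss. Qed.

Lemma edge_ok_flip seen s e : edge_ok seen (flip s e) = edge_ok seen e.
Proof. by []. Qed.

End Circuits.

(** * Pruning a single node *)

Section Redirection.
Variables (R : realType) (n N : nat) (C : chains n) (eta : 'I_n -> R).
Hypothesis eta_ge0 : forall i, 0 <= eta i.
Hypothesis eta_rep : forall r, eta (rep C r) <= eta r.
Notation tpoly := {malg {mpoly R[n + N]}[texp R]}.
Notation src := (@curve R n N C eta).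
Notation redirect := (redirect C eta).
Notation process := (@process R n N C eta).
Implicit Types (e : edge n N) (g : gate n N) (env : 'I_N -> tpoly) (T U : tpoly).

Definition monomial T : Prop := exists a v, T = << a *g v >>.

Lemma signed_mono (s : bool) (a : {mpoly R[n + N]}) (v : texp R) :
  signed s (<< a *g v >> : tpoly) = << signed s a *g v >>.
Proof. by case: s; rewrite //= monalg.monalgUN. Qed.

Lemma monomial_signed (s : bool) T : monomial T -> monomial (signed s T).
Proof. by case=> a [v ->]; exists (signed s a), v; rewrite signed_mono. Qed.

Lemma monomialM T U : monomial T -> monomial U -> monomial (T * U).
Proof.
by move=> [a [u ->]] [b [v ->]]; exists (a * b), (monalg.mmul u v); apply: monalg.fgmulUU.
Qed.

Lemma monomialD T U : lowdeg T = lowdeg U -> monomial T -> monomial U ->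
  monomial (T + U).
Proof.
move=> TU [a [u Tu]] [b [v Uv]]; rewrite {}Tu {}Uv in TU *.
have [->|a0] := eqVneq a 0; first by rewrite monalg.monalgU0 add0r; exists b, v.
have [->|b0] := eqVneq b 0; first by rewrite monalg.monalgU0 addr0; exists a, u.
move: TU; rewrite (lowdeg_mono _ a0) (lowdeg_mono _ b0) => -[/val_inj->].
by exists (a + b), v; rewrite monalg.monalgUD.
Qed.

Lemma signed_neq0 (A : zmodType) (s : bool) (a : A) : (signed s a != 0) = (a != 0).
Proof. by case: s; rewrite //= oppr_eq0. Qed.

Lemma signedD (A : zmodType) (s : bool) (a b : A) :
  signed s (a + b) = signed s a + signed s b.
Proof. by case: s; rewrite //= opprD. Qed.

Lemma signedK (A : zmodType) (s t : bool) (a : A) :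
  signed s (signed t a) = signed (s (+) t) a.
Proof. by case: s; case: t; rewrite //= opprK. Qed.

Lemma variable_neq0 (m : nat) (i : 'I_m) : 'X_i != 0 :> {mpoly R[m]}.
Proof.
apply/eqP => /(congr1 (meval (fun=> 1))).
by rewrite mevalXU meval0 => /eqP; rewrite oner_eq0.
Qed.

Lemma val_eta i : val (insubd (texp0 R) (eta i)) = eta i.
Proof. by rewrite val_insubd eta_ge0. Qed.

Lemma source_single env e r : org e = inl r -> ~~ (eta (rep C r) < eta r) ->
  exists a u, a != 0 /\ edge_val src env e = << a *g u >>.
Proof.
rewrite /edge_val /curve /old_coord => -> nlt.
case: eqVneq => [rr|rr].
  exists (signed (neg e) 'X_(lshift N r)), (insubd (texp0 R) (eta r)).
  by rewrite signed_neq0 variable_neq0 signed_mono.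
have eq : eta (rep C r) = eta r by apply: le_anti; rewrite eta_rep leNgt.
rewrite /letter eq.
exists (signed (neg e) ('X_(lshift N r) + signed (sgn C r) 'X_(lshift N (rep C r)))).
exists (insubd (texp0 R) (eta r)); split; last first.
  by rewrite !signedD !signed_mono monalg.monalgUD.
rewrite signed_neq0; apply/eqP.
move=> /(congr1 (meval (fun k => (k == lshift N r)%:R))).
rewrite mevalD meval0 mevalXU eqxx => /eqP; case: (sgn C r) => /=.
  by rewrite mevalN mevalXU (inj_eq (@lshift_inj _ _)) (negPf rr) oppr0 addr0 oner_eq0.
by rewrite mevalXU (inj_eq (@lshift_inj _ _)) (negPf rr) addr0 oner_eq0.
Qed.

Lemma source_double env e r : org e = inl r -> eta (rep C r) < eta r ->
  edge_val src env e =
    << signed (neg e (+) sgn C r) 'X_(lshift N (rep C r))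
         *g insubd (texp0 R) (eta (rep C r)) >> +
    << signed (neg e) 'X_(lshift N r) *g insubd (texp0 R) (eta r) >>.
Proof.
rewrite /edge_val /curve /old_coord => -> lt.
case: eqVneq => [rr|rr]; first by rewrite rr ltxx in lt.
by rewrite !signedD !signed_mono signedK; apply: addrC.
Qed.

(** A source is either homogeneous in [t] and not redirected, or it has a
    second term and redirecting it keeps exactly its lowest-degree term. *)
Lemma source_form env e : is_source e ->
  (redirect e = e /\
   exists a u, a != 0 /\ edge_val src env e = << a *g u >>) \/
  exists a u b w, [/\ a != 0, b != 0, val u < val w,
    edge_val src env e = << a *g u >> + << b *g w >> &
    edge_val src env (redirect e) = << a *g u >>].
Proof.
rewrite /is_source /Defs.redirect; case eE: (org e) => [r|//] _.
case: ifPn => [lt|nlt]; last by left; split=> //; apply: source_single eE nlt.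
right; exists (signed (neg e (+) sgn C r) 'X_(lshift N (rep C r))).
exists (insubd (texp0 R) (eta (rep C r))).
exists (signed (neg e) 'X_(lshift N r)), (insubd (texp0 R) (eta r)).
split; last by rewrite /edge_val /= /curve /old_coord rep_idem eqxx signed_mono.
- by rewrite signed_neq0 variable_neq0.
- by rewrite signed_neq0 variable_neq0.
- by rewrite 2!val_eta.
exact: source_double eE lt.
Qed.

Lemma redirect_node e : ~~ is_source e -> redirect e = e.
Proof. by case: e => s []. Qed.

Lemma redirect_flip s e : redirect (flip s e) = flip s (redirect e).
Proof.
case: e => t [r|//]; rewrite /Defs.redirect /flip /=.
by case: ifP => //=; rewrite addbA.
Qed.

Lemma redirect_lowdeg env e :
  lowdeg (edge_val src env (redirect e)) = lowdeg (edge_val src env e).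
Proof.
case: (boolP (is_source e)) => [es|/redirect_node->//].
have [[->//]|[a [u [b [w [a0 b0 uw -> ->]]]]]] := source_form env es.
by rewrite (lowest_lowdeg (lowest_two b a0 uw)) lowdeg_mono.
Qed.

(** Redirecting a source changes only its second term, whose degree exceeds the
    degree up to which the tracked value is prescribed. *)
Lemma redirect_tracks Z V env e :
  tracks Z V (edge_val src env e) -> tracks Z V (edge_val src env (redirect e)).
Proof.
case: (boolP (is_source e)) => [es|/redirect_node->//].
have [[->//]|[a [u [b [w [a0 b0 uw -> ->]]]]]] := source_form env es.
have [En Eb] := lowest_two b a0 uw.
case=> [[_ T0]|[v [Vv Tv VT]]].
  by rewrite T0 monalg.mcoeff0 eqxx in En.
have vu : val v <= val u by rewrite leNgt; apply: contra En => /Tv ->.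
right; exists v; split=> // [x xv|y Zy].
  apply: etrans (esym (coeff_two_le a b uw _)) (Tv x xv).
  exact: ltW (lt_le_trans xv vu).
by apply: etrans (VT y Zy) (congr1 (meval y) (coeff_two_le a b uw vu)).
Qed.

Definition node_monomial env e : Prop := ~~ is_source e -> monomial (edge_val src env e).

Lemma node_monomial_flip env s e : node_monomial env e -> node_monomial env (flip s e).
Proof. by move=> em es; rewrite edge_val_flip; apply/monomial_signed/em. Qed.

Lemma redirect_monomial env e : node_monomial env e ->
  monomial (edge_val src env (redirect e)).
Proof.
move=> em; case: (boolP (is_source e)) => [es|es]; last first.
  by rewrite redirect_node //; apply: em.
have [[-> [a [u [_ ->]]]]|[a [u [b [w [_ _ _ _ ->]]]]]] := source_form env es.
  by exists a, u.
by exists a, u.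
Qed.

End Redirection.

Section Cancellation.
Variables (A : zmodType) (a b c d : A).
Hypothesis ac0 : a + c = 0.

Lemma add_cancel4 : a + b + (c + d) = b + d.
Proof. by rewrite addrACA ac0 add0r. Qed.

Lemma add_cancelr : a + (c + d) = d.
Proof. by rewrite addrA ac0 add0r. Qed.

Lemma add_cancell : a + b + c = b.
Proof. by rewrite addrAC ac0 add0r. Qed.

End Cancellation.

Lemma second_degree_case (R : realType) (X : Type) (a b : R) (x y z : X) :
  (if [|| a%:E == +oo%E, b%:E == +oo%E | a%:E == b%:E] then x
   else if (a%:E < b%:E)%E then y else z) =
  if a == b then x else if a < b then y else z.
Proof. by rewrite eqe lte_fin. Qed.

Section Process.
Variables (R : realType) (n N : nat) (C : chains n) (eta : 'I_n -> R).
Hypothesis eta_ge0 : forall i, 0 <= eta i.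
Hypothesis eta_rep : forall r, eta (rep C r) <= eta r.
Notation tpoly := {malg {mpoly R[n + N]}[texp R]}.
Notation src := (@curve R n N C eta).
Notation redirect := (redirect C eta).
Notation process := (@process R n N C eta).
Implicit Types (e : edge n N) (g : gate n N) (env : 'I_N -> tpoly) (T U : tpoly).

Lemma lowtermN T : lowterm (- T) = - lowterm T.
Proof.
have [->|/lowest_exists[v Tv]] := eqVneq T 0; first by rewrite oppr0 lowterm0 oppr0.
rewrite (lowterm_lowest Tv) (lowterm_lowest (lowestN Tv)).
by rewrite monalg.mcoeffN monalg.monalgUN.
Qed.

Lemma lowdeg2N T : lowdeg2 (- T) = lowdeg2 T.
Proof. by rewrite /lowdeg2 lowtermN -opprD lowdegN. Qed.

Definition redirected e e' : Prop := e' = e \/ e' = redirect e.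

(** The situations that arise for two original values [V1] and [V2] about to be
    added and the wires [e1] and [e2] that replace them. The last one is a node
    subtracted from itself. *)
Definition sum_inputs V1 V2 env e1 e2 : Prop :=
  [\/ no_cancel V1 V2,
      [/\ is_source e1, is_source e2, V1 = edge_val src env e1 &
          V2 = edge_val src env e2] |
      [/\ V1 + V2 = 0, edge_val src env e1 + edge_val src env e2 = 0 &
          is_source e1 = is_source e2] ].

Lemma redirected_tracks Z V env e e' : redirected e e' ->
  tracks Z V (edge_val src env e) -> tracks Z V (edge_val src env e').
Proof. by case=> -> //; apply: redirect_tracks. Qed.

Lemma sum_no_cancel V1 V2 env e1 e2 : sum_inputs V1 V2 env e1 e2 ->
  lowdeg (edge_val src env e1) != lowdeg (edge_val src env e2) -> no_cancel V1 V2.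
Proof.
case=> [//|[_ _ -> ->]|[_ /eqP UV _]]; first exact: no_cancel_lowdeg.
by rewrite addr_eq0 in UV; rewrite (eqP UV) lowdegN eqxx.
Qed.

(** In each of the situations above, a cancellation forces the replacements to
    have equal degrees, so that nothing cancels when a node is deleted. *)
Lemma tracks_delete Z V1 V2 env e1 e2 : sum_inputs V1 V2 env e1 e2 ->
  tracks Z V1 (edge_val src env e1) -> tracks Z V2 (edge_val src env e2) ->
  (lowdeg (edge_val src env e1) < lowdeg (edge_val src env e2))%E ->
  tracks Z (V1 + V2) (edge_val src env e1).
Proof.
move=> inputs tr1 tr2 lt12; apply: (tracks_drop tr1 tr2 _ lt12).
by apply: (sum_no_cancel inputs); rewrite (lt_eqF lt12).
Qed.

Lemma sum_redirect_both Z V1 V2 env e1 e2 : sum_inputs V1 V2 env e1 e2 ->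
  node_monomial C eta env e1 -> node_monomial C eta env e2 ->
  tracks Z V1 (edge_val src env e1) -> tracks Z V2 (edge_val src env e2) ->
  lowdeg (edge_val src env e1) = lowdeg (edge_val src env e2) ->
  ~~ [&& is_source e1, is_source e2 &
      lowterm (edge_val src env e1) + lowterm (edge_val src env e2) == 0] ->
  let W := edge_val src env (redirect e1) + edge_val src env (redirect e2) in
  tracks Z (V1 + V2) W /\ monomial W.
Proof.
move=> inputs m1 m2 tr1 tr2 deg12 no_source_cancel W; split; last first.
  by apply: monomialD; rewrite ?redirect_lowdeg //; apply: redirect_monomial.
have noc : no_cancel V1 V2 -> tracks Z (V1 + V2) W.
  by move=> nc; rewrite /W; apply: tracksD => //; apply: redirect_tracks.
case: inputs => [//|[s1 s2 E1 E2]|[V0 U0 s12]].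
  apply: noc; rewrite E1 E2; apply: no_cancel_lowterm.
  by move: no_source_cancel; rewrite s1 s2.
move: no_source_cancel; have /eqP := U0; rewrite addr_eq0 => /eqP U12.
rewrite U12 lowtermN addNr eqxx andbT -s12 andbb => ns.
left; split=> //; rewrite /W !redirect_node //; last by rewrite -s12.
Qed.

(** Two sources with cancelling lowest-degree terms: what remains of the sum is
    governed by the second terms, and the rule keeps the one of lower degree. *)
Lemma sum_source_cancel Z V1 V2 env e1 e2 (U1 := edge_val src env e1)
    (U2 := edge_val src env e2) : sum_inputs V1 V2 env e1 e2 ->
  is_source e1 -> is_source e2 -> tracks Z V1 U1 -> tracks Z V2 U2 ->
  lowterm U1 + lowterm U2 = 0 ->
  let du := lowdeg2 U1 in
  let dv := lowdeg2 U2 in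
  let es := if [|| du == +oo%E, dv == +oo%E | du == dv] then (e1, e2)
            else if (du < dv)%E then (e1, redirect e2) else (redirect e1, e2) in
  let W := edge_val src env es.1 + edge_val src env es.2 in
  tracks Z (V1 + V2) W /\ monomial W.
Proof.
move=> inputs s1 s2 tr1 tr2 low0 du dv es W.
have es_redirected : redirected e1 es.1 /\ redirected e2 es.2.
  by rewrite /es; case: ifP => _; [|case: ifP => _]; split; (try by left); right.
have keep : es = (e1, e2) -> monomial (U1 + U2) -> tracks Z (U1 + U2) W /\ monomial W.
  move=> esE mU; have -> : W = U1 + U2 by rewrite /W esE.
  by split=> //; apply: tracks_refl.
have tr_drop (b b' : {mpoly R[n + N]}) (w w' : texp R) : b != 0 -> b' != 0 ->
    val w < val w' -> tracks Z ((<< b *g w >> : tpoly) + << b' *g w' >>) << b *g w >>.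
  move=> b0 b0' ww'; apply: tracks_drop (tracks_refl _ _) (tracks_refl _ _) _ _.
    by apply: no_cancel_lowdeg; rewrite (lowdeg_mono _ b0) (lowdeg_mono _ b0') eqe lt_eqF.
  by rewrite (lowdeg_mono _ b0) (lowdeg_mono _ b0') lte_fin.
have low (c1 c2 : tpoly) : lowterm U1 = c1 -> lowterm U2 = c2 -> c1 + c2 = 0.
  by move=> <- <-.
have [tr_sum mW] : tracks Z (U1 + U2) W /\ monomial W.
  case: (source_form eta_ge0 eta_rep env s1) => [[_ [a1 [u1 [a10 E1]]]]|];
  case: (source_form eta_ge0 eta_rep env s2) => [[_ [a2 [u2 [a20 E2]]]]|].
  - apply: keep; first by rewrite /es /du /U1 E1 lowdeg2_mono.
    have {}low0 : << a1 *g u1 >> + << a2 *g u2 >> = 0 :> tpoly.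
      apply: low; first by rewrite /U1 E1; apply: lowterm_mono.
      by rewrite /U2 E2; apply: lowterm_mono.
    by exists 0, u1; rewrite /U1 /U2 E1 E2 low0 monalg.monalgU0.
  - move=> [a2 [u2 [b2 [w2 [a20 b20 uw2 E2 R2]]]]].
    apply: keep; first by rewrite /es /du /U1 E1 lowdeg2_mono.
    have {}low0 : << a1 *g u1 >> + << a2 *g u2 >> = 0 :> tpoly.
      apply: low; first by rewrite /U1 E1; apply: lowterm_mono.
      by rewrite /U2 E2; apply: lowterm_two.
    by exists b2, w2; rewrite /U1 /U2 E1 E2; apply: add_cancelr.
  - move=> [a1 [u1 [b1 [w1 [a10 b10 uw1 E1 R1]]]]].
    apply: keep; first by rewrite /es /dv /U2 E2 lowdeg2_mono eqxx orbT.
    have {}low0 : << a1 *g u1 >> + << a2 *g u2 >> = 0 :> tpoly.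
      apply: low; first by rewrite /U1 E1; apply: lowterm_two.
      by rewrite /U2 E2; apply: lowterm_mono.
    by exists b1, w1; rewrite /U1 /U2 E1 E2; apply: add_cancell.
  move=> [a2 [u2 [b2 [w2 [a20 b20 uw2 E2 R2]]]]].
  move=> [a1 [u1 [b1 [w1 [a10 b10 uw1 E1 R1]]]]].
  have duE : du = (val w1)%:E by rewrite /du /U1 E1 (lowdeg2_two a10 b10 uw1).
  have dvE : dv = (val w2)%:E by rewrite /dv /U2 E2 (lowdeg2_two a20 b20 uw2).
  have {}low0 : << a1 *g u1 >> + << a2 *g u2 >> = 0 :> tpoly.
    apply: low; first by rewrite /U1 E1; apply: lowterm_two.
    by rewrite /U2 E2; apply: lowterm_two.
  have sumE : U1 + U2 = << b1 *g w1 >> + << b2 *g w2 >>.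
    by rewrite /U1 /U2 E1 E2; apply: add_cancel4.
  have esE : es = if val w1 == val w2 then (e1, e2)
      else if val w1 < val w2 then (e1, redirect e2) else (redirect e1, e2).
    by rewrite /es duE dvE second_degree_case.
  case: (ltgtP (val w1) (val w2)) esE => w12 esE.
  - have -> : W = << b1 *g w1 >>.
      by rewrite /W esE /= E1 R2; apply: add_cancell.
    by rewrite sumE; split; [apply: tr_drop | exists b1, w1].
  - have -> : W = << b2 *g w2 >>.
      by rewrite /W esE /= R1 E2; apply: add_cancelr.
    by rewrite sumE addrC; split; [apply: tr_drop | exists b2, w2].
  apply: keep => //; rewrite sumE.
  by exists (b1 + b2), w1; rewrite (val_inj w12) -monalg.monalgUD.
split=> //; case: inputs => [nc|[_ _ -> -> //]|[V0 U0 _]].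
  case: es_redirected => r1 r2.
  by apply: tracksD nc; [apply: redirected_tracks r1 _ | apply: redirected_tracks r2 _].
left; split=> //.
have esE : es = (e1, e2).
  have /eqP : U1 + U2 = 0 by []; rewrite addr_eq0 => /eqP U12.
  by rewrite /es /du /dv U12 lowdeg2N eqxx !orbT.
by rewrite /W esE.
Qed.

End Process.

Section Fates.
Variables (R : realType) (n N : nat) (C : chains n) (eta : 'I_n -> R).
Hypothesis eta_ge0 : forall i, 0 <= eta i.
Hypothesis eta_rep : forall r, eta (rep C r) <= eta r.
Notation tpoly := {malg {mpoly R[n + N]}[texp R]}.
Notation src := (@curve R n N C eta).
Notation redirect := (redirect C eta).
Notation process := (@process R n N C eta).
Notation redirected := (redirected C eta).
Notation node_monomial := (node_monomial C eta).
Notation sum_inputs := (sum_inputs C eta).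
Implicit Types (e : edge n N) (g : gate n N) (env : 'I_N -> tpoly).

(** [V] is the original value before rounding. A deleted node loses its rounding
    factor, so that the edge taking its place tracks [V] itself. *)
Definition fate_tracks Z (V : tpoly) env g (f : fate n N) : Prop :=
  match f with
  | Keep k =>
      [/\ gname k = gname g, redirected (lhs g) (lhs k), redirected (rhs g) (rhs k),
          tracks Z (V * (1 + tdelta R n (gname g))) (gate_val src (@tdelta R n N) env k) &
          monomial (gate_val src (@tdelta R n N) env k)]
  | Delete e =>
      (e = lhs g \/ exists s, e = flip s (rhs g)) /\ tracks Z V (edge_val src env e)
  end.

Arguments fate_tracks : simpl never.

Lemma monomial_rounding i : monomial (1 + tdelta R n i : tpoly).
Proof. by exists (1 + 'X_(rshift n i)), (texp0 R); apply: rounding_factorE. Qed.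

Lemma keep_tracks Z V env g k : gname k = gname g ->
  redirected (lhs g) (lhs k) -> redirected (rhs g) (rhs k) -> gop k <> Mul ->
  tracks Z V (edge_val src env (lhs k) + edge_val src env (flip (is_sub (gop k)) (rhs k))) ->
  monomial (edge_val src env (lhs k) + edge_val src env (flip (is_sub (gop k)) (rhs k))) ->
  fate_tracks Z V env g (Keep k).
Proof.
move=> kg kl kr kM VW mW; rewrite /fate_tracks gate_val_sum // kg; split=> //.
  by apply: tracksM VW (tracks_refl _ _).
by apply: monomialM mW (monomial_rounding _).
Qed.

Lemma process_sum Z V1 V2 env g (e1 := lhs g) (e2 := flip (is_sub (gop g)) (rhs g)) :
  gop g <> Mul -> sum_inputs V1 V2 env e1 e2 ->
  node_monomial env e1 -> node_monomial env e2 ->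
  tracks Z V1 (edge_val src env e1) -> tracks Z V2 (edge_val src env e2) ->
  fate_tracks Z (V1 + V2) env g (process env g).
Proof.
move=> gM inputs m1 m2 tr1 tr2; rewrite /Defs.process.
have -> (X : Type) (x y : X) : (if gop g is Mul then x else y) = y by case: gop gM.
rewrite -edge_val_flip -/e1 -/e2 /=.
have redirect_rhs : redirect e2 = flip (is_sub (gop g)) (redirect (rhs g)).
  exact: redirect_flip.
case: ltP => [lt21|le12].
  split; first by right; exists (is_sub (gop g)).
  rewrite addrC; apply: (tracks_delete (e2 := e1)) tr2 tr1 lt21.
  case: inputs => [nc|[s1 s2 -> ->]|[V0 U0 s12]].
  - by constructor 1; apply: no_cancelC.
  - by constructor 2.
  by constructor 3; split=> //; rewrite addrC.
case: ltP => [lt12|le21].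
  by split; [left | apply: tracks_delete inputs tr1 tr2 lt12].
have deg12 : lowdeg (edge_val src env e1) = lowdeg (edge_val src env e2).
  by apply: le_anti; rewrite le12 le21.
case: ifP => [/and3P[s1 s2 /eqP low0]|/negbT no_source_cancel]; last first.
  have [] := sum_redirect_both eta_ge0 eta_rep inputs m1 m2 tr1 tr2 deg12 no_source_cancel.
  rewrite redirect_rhs.
  exact: (@keep_tracks Z (V1 + V2) env g (redirect_both C eta g)
    erefl (or_intror erefl) (or_intror erefl) gM).
pose du := lowdeg2 (edge_val src env e1); pose dv := lowdeg2 (edge_val src env e2).
rewrite -/du -/dv; pose c1 := [|| du == +oo%E, dv == +oo%E | du == dv].
pose c2 := (du < dv)%E; rewrite -/c1 -/c2.
pose es := if c1 then (e1, e2) else if c2 then (e1, redirect e2) else (redirect e1, e2).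
have [] : tracks Z (V1 + V2) (edge_val src env es.1 + edge_val src env es.2) /\
    monomial (edge_val src env es.1 + edge_val src env es.2).
  exact: (sum_source_cancel eta_ge0 eta_rep inputs s1 s2 tr1 tr2 low0).
rewrite {}/es; case: c1.
  exact: (@keep_tracks Z (V1 + V2) env g g erefl (or_introl erefl) (or_introl erefl) gM).
case: c2; last first.
  exact: (@keep_tracks Z (V1 + V2) env g (Gate (gname g) (gop g) (redirect (lhs g)) (rhs g))
    erefl (or_intror erefl) (or_introl erefl) gM).
rewrite [(_, _).2]/= redirect_rhs.
exact: (@keep_tracks Z (V1 + V2) env g (Gate (gname g) (gop g) (lhs g) (redirect (rhs g)))
  erefl (or_introl erefl) (or_intror erefl) gM).
Qed.

Lemma process_mul Z V1 V2 env g : gop g = Mul ->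
  node_monomial env (lhs g) -> node_monomial env (rhs g) ->
  tracks Z V1 (edge_val src env (lhs g)) -> tracks Z V2 (edge_val src env (rhs g)) ->
  fate_tracks Z (V1 * V2) env g (process env g).
Proof.
move=> gM m1 m2 tr1 tr2; rewrite /Defs.process gM /fate_tracks /= gate_val_mul //=.
split; [by []|by right|by right| |].
  by apply: tracksM (tracks_refl _ _); apply: tracksM; apply: redirect_tracks.
by apply: monomialM (monomial_rounding _); apply: monomialM; apply: redirect_monomial.
Qed.

End Fates.

(** * Pruning the whole circuit *)

Section PruneInvariant.
Variables (R : realType) (n N : nat) (C : chains n) (eta : 'I_n -> R).
Hypothesis eta_ge0 : forall i, 0 <= eta i.
Hypothesis eta_rep : forall r, eta (rep C r) <= eta r.
Notation tpoly := {malg {mpoly R[n + N]}[texp R]}.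
Notation src := (@curve R n N C eta).
Notation delta := (@tdelta R n N).
Implicit Types (e : edge n N) (g : gate n N) (env : 'I_N -> tpoly).
Implicit Types (seen D kept : seq 'I_N) (subst : 'I_N -> edge n N).

Definition vanish D (y : 'I_(n + N) -> R) : Prop :=
  forall i, i \in D -> y (rshift n i) = 0.

(** The rounding factors of the original nodes: distinct nodes have distinct
    rounding errors, and one of two nodes precedes the other. *)
Record rounded seen env : Prop := Rounded {
  rounded_killed : forall i, i \in seen -> killed (rshift n i) (env i);
  rounded_fresh : forall i l, i \in seen -> l \notin seen ->
    independent (rshift n l) (env i);
  rounded_order : forall i j, i \in seen -> j \in seen -> i != j ->
    independent (rshift n j) (env i) \/ independent (rshift n i) (env j) }.

Record pruned seen D kept envV envW subst : Prop := Pruned {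
  pruned_rounded : rounded seen envV;
  pruned_tracks : forall i, i \in seen ->
    tracks (vanish D) (envV i) (edge_val src envW (subst i));
  pruned_ok : forall i, i \in seen -> edge_ok kept (subst i);
  pruned_fresh : forall l, l \notin seen -> subst l = Edge false (inr l);
  pruned_monomial : forall j, j \in kept -> monomial (envW j);
  pruned_kept : forall j, j \in kept -> (j \in seen) && (j \notin D);
  pruned_deleted : forall j, j \in D -> j \in seen }.

Lemma independent_curve i k : independent (rshift n i) (src k : tpoly).
Proof.
rewrite /curve /old_coord; case: ifP => _; first exact: independent_letter.
apply: independentD; first exact: independent_letter.
by apply: independent_signed; apply: independent_letter.
Qed.

Lemma edge_independent seen env e l : rounded seen env -> edge_ok seen e ->
  l \notin seen -> independent (rshift n l) (edge_val src env e).
Proof.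
move=> inv; rewrite /edge_ok /edge_val => eok lseen; apply: independent_signed.
case: (org e) eok => [k _|i iseen]; first exact: independent_curve.
exact: rounded_fresh inv _ _ iseen lseen.
Qed.

(** The value of a node is a function of earlier ones times its rounding factor,
    which introduces an error that no earlier node contains. *)
Lemma rounded_step seen env g : rounded seen env -> gname g \notin seen ->
  edge_ok seen (lhs g) -> edge_ok seen (rhs g) ->
  rounded (gname g :: seen) (upd env (gname g) (gate_val src delta env g)).
Proof.
move=> inv; set i := gname g => iseen lok rok.
have neq j : j \in seen -> (j == i) = false.
  by move=> js; apply: contraNF iseen => /eqP <-.
pose V := match gop g with
  | Add => edge_val src env (lhs g) + edge_val src env (rhs g)
  | Sub => edge_val src env (lhs g) - edge_val src env (rhs g)
  | Mul => edge_val src env (lhs g) * edge_val src env (rhs g) end.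
have valE : gate_val src delta env g = V * (1 + delta i) by [].
have Vind l : l \notin seen -> independent (rshift n l) V.
  move=> lseen; have L := edge_independent inv lok lseen.
  have Rr := edge_independent inv rok lseen; rewrite /V; case: (gop g).
  - exact: independentD.
  - by apply: independentD => //; apply: (independent_signed true).
  exact: independentM.
have gind l : l \notin i :: seen -> independent (rshift n l) (gate_val src delta env g).
  rewrite inE negb_or => /andP[li lseen]; rewrite valE.
  by apply: independentM; [apply: Vind | apply: independent_rounding].
split.
- move=> j; rewrite inE /upd => /predU1P[->|js].
    by rewrite eqxx valE; apply: killed_rounding.
  by rewrite (neq _ js); apply: rounded_killed inv _ js.
- move=> j l; rewrite inE /upd => /predU1P[->|js] ls; first by rewrite eqxx; apply: gind.
  rewrite (neq _ js); apply: (rounded_fresh inv js).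
  by move: ls; rewrite inE negb_or => /andP[].
move=> j k; rewrite !inE /upd => /predU1P[->|js] /predU1P[->|ks]; rewrite ?eqxx //.
- by move=> _; right; rewrite (neq _ ks); apply: (rounded_fresh inv ks).
- by move=> _; left; rewrite (neq _ js); apply: (rounded_fresh inv js).
by rewrite (neq _ js) (neq _ ks); apply: (rounded_order inv).
Qed.

Lemma resolve_flip subst s e : resolve subst (flip s e) = flip s (resolve subst e).
Proof. by case: e => t [k|i]; rewrite /resolve /flip /= ?addbA. Qed.

Lemma resolve_node subst e i : org e = inr i ->
  resolve subst e = flip (neg e) (subst i).
Proof. by rewrite /resolve => ->. Qed.

Lemma resolve_source subst e : is_source e -> resolve subst e = e.
Proof. by rewrite /is_source /resolve; case: (org e). Qed.

Section Edges.
Variables (seen D kept : seq 'I_N) (envV envW : 'I_N -> tpoly).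
Variable subst : 'I_N -> edge n N.
Hypothesis inv : pruned seen D kept envV envW subst.

Lemma edge_source_val env e k : org e = inl k -> edge_val src envV e = edge_val src env e.
Proof. by rewrite /edge_val => ->. Qed.

Lemma edge_node_val env e i : org e = inr i -> edge_val src env e = signed (neg e) (env i).
Proof. by rewrite /edge_val => ->. Qed.

Lemma edge_tracks e : edge_ok seen e ->
  tracks (vanish D) (edge_val src envV e) (edge_val src envW (resolve subst e)).
Proof.
rewrite /edge_ok; case eE: (org e) => [k|i] iseen.
  rewrite resolve_source /is_source ?eE // (edge_source_val envW eE).
  exact: tracks_refl.
rewrite (resolve_node _ eE) edge_val_flip (edge_node_val _ eE).
by apply: tracks_signed; apply: pruned_tracks inv _ iseen.
Qed.

Lemma edge_resolve_ok e : edge_ok seen e -> edge_ok kept (resolve subst e).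
Proof.
rewrite /edge_ok; case eE: (org e) => [k|i] iseen.
  by rewrite resolve_source /is_source ?eE.
by rewrite (resolve_node _ eE); apply: pruned_ok inv _ iseen.
Qed.

Lemma edge_monomial e : edge_ok kept e -> node_monomial C eta envW e.
Proof.
rewrite /edge_ok /node_monomial /is_source; case eE: (org e) => [//|i] ik _.
by rewrite (edge_node_val _ eE); apply/monomial_signed/(pruned_monomial inv).
Qed.

(** The lowest-degree terms of two original values cancel only for sources and
    for opposite values of one node: of two different nodes, the later carries a
    rounding factor that vanishes where its rounding error is [-1], while the
    earlier one does not depend on this error. *)
Lemma edge_sum_inputs e1 e2 : edge_ok seen e1 -> edge_ok seen e2 ->
  sum_inputs C eta (edge_val src envV e1) (edge_val src envV e2) envW
    (resolve subst e1) (resolve subst e2).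
Proof.
have rinv := pruned_rounded inv.
move=> ok1 ok2; move: (ok1) (ok2); rewrite {1}/edge_ok {1}/edge_ok.
case E1: (org e1) => [k1|i1] i1s; case E2: (org e2) => [k2|i2] i2s.
- constructor 2; rewrite !resolve_source /is_source ?E1 ?E2 //.
  by rewrite -(edge_source_val envW E1) -(edge_source_val envW E2).
- constructor 1; apply: (@no_cancel_killed _ _ (rshift n i2)).
    by rewrite /edge_val E1; apply/independent_signed/independent_curve.
  by rewrite (edge_node_val _ E2); apply/killed_signed/(rounded_killed rinv).
- constructor 1; apply: no_cancelC; apply: (@no_cancel_killed _ _ (rshift n i1)).
    by rewrite /edge_val E2; apply/independent_signed/independent_curve.
  by rewrite (edge_node_val _ E1); apply/killed_signed/(rounded_killed rinv).
rewrite (resolve_node _ E1) (resolve_node _ E2) (edge_node_val _ E1) (edge_node_val _ E2).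
have [i12|i12] := eqVneq i1 i2; last first.
  constructor 1; have [ind|ind] := rounded_order rinv i1s i2s i12.
    apply: (@no_cancel_killed _ _ (rshift n i2)).
      exact: independent_signed.
    exact/killed_signed/(rounded_killed rinv).
  apply: no_cancelC; apply: (@no_cancel_killed _ _ (rshift n i1)).
    exact: independent_signed.
  exact/killed_signed/(rounded_killed rinv).
rewrite -i12; have [->|s12] := eqVneq (neg e1) (neg e2).
  by constructor 1; apply: no_cancel_refl.
constructor 3; rewrite !edge_val_flip; split=> //.
  by case: (neg e1) s12; case: (neg e2) => //= _; rewrite ?addNr ?subrr.
by case: (neg e1) s12; case: (neg e2) => //= _; rewrite ?addNr ?subrr.
Qed.

Definition resolved g : gate n N :=
  Gate (gname g) (gop g) (resolve subst (lhs g)) (resolve subst (rhs g)).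

Definition unrounded_val env g : tpoly :=
  match gop g with
  | Mul => edge_val src env (lhs g) * edge_val src env (rhs g)
  | _ => edge_val src env (lhs g) + edge_val src env (flip (is_sub (gop g)) (rhs g))
  end.

Lemma gate_val_unrounded g : gate_val src delta envV g =
  unrounded_val envV g * (1 + delta (gname g)).
Proof. by rewrite /gate_val /unrounded_val; case: (gop g); rewrite ?edge_val_flip. Qed.

Lemma process_tracks g : edge_ok seen (lhs g) -> edge_ok seen (rhs g) ->
  fate_tracks C eta (vanish D) (unrounded_val envV g) envW (resolved g)
    (process C eta envW (resolved g)).
Proof.
move=> lok rok; have lmono := edge_monomial (edge_resolve_ok lok).
have rmono := edge_monomial (edge_resolve_ok rok).
have sum_case : gop g <> Mul -> fate_tracks C eta (vanish D)
    (edge_val src envV (lhs g) + edge_val src envV (flip (is_sub (gop g)) (rhs g)))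
    envW (resolved g) (process C eta envW (resolved g)).
  move=> gM; apply: process_sum; rewrite /= -?resolve_flip //.
  - exact: edge_sum_inputs.
  - by rewrite resolve_flip; apply: node_monomial_flip.
  - exact: edge_tracks.
  - exact: edge_tracks.
rewrite /unrounded_val; case gE: (gop g) sum_case => sum_case; try exact: sum_case.
apply: (process_mul eta_ge0 eta_rep (g := resolved g)) => //=; exact: edge_tracks.
Qed.

End Edges.
End PruneInvariant.

Section PruneGates.
Variables (R : realType) (n N : nat) (C : chains n) (eta : 'I_n -> R).
Hypothesis eta_ge0 : forall i, 0 <= eta i.
Hypothesis eta_rep : forall r, eta (rep C r) <= eta r.
Notation tpoly := {malg {mpoly R[n + N]}[texp R]}.
Notation src := (@curve R n N C eta).
Notation delta := (@tdelta R n N).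
Notation pruned := (@pruned R n N C eta).
Implicit Types (e : edge n N) (g : gate n N).

Lemma redirected_ok (kept : seq 'I_N) e e' : redirected C eta e e' ->
  edge_ok kept e -> edge_ok kept e'.
Proof.
case=> -> //; case: e => t [k|i]; rewrite /redirect //=.
by case: ifP.
Qed.

Lemma keep_step seen D kept envV envW subst g k : pruned seen D kept envV envW subst ->
  gname g \notin seen -> edge_ok seen (lhs g) -> edge_ok seen (rhs g) ->
  process C eta envW (resolved subst g) = Keep k ->
  [/\ gname k = gname g, gates_ok kept [:: k] &
    pruned (gname g :: seen) D (gname g :: kept)
      (upd envV (gname g) (gate_val src delta envV g))
      (upd envW (gname g) (gate_val src delta envW k)) subst].
Proof.
move=> inv iseen lok rok kE.
have := process_tracks eta_ge0 eta_rep inv lok rok; rewrite kE.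
move=> [/= kg kl kr Vk mk].
have neq j : j \in seen -> (j == gname g) = false.
  by move=> js; apply: contraNF iseen => /eqP <-.
have ikept : gname g \notin kept.
  by apply: contra iseen => /(pruned_kept inv)/andP[].
split=> //.
  rewrite kg ikept (redirected_ok kl (edge_resolve_ok inv lok)).
  by rewrite (redirected_ok kr (edge_resolve_ok inv rok)).
split.
- exact: rounded_step (pruned_rounded inv) iseen lok rok.
- move=> j; rewrite inE {1}/upd => /predU1P[->|js].
    rewrite (pruned_fresh inv) // eqxx /edge_val /= /upd eqxx.
    by rewrite (gate_val_unrounded C eta envV g).
  rewrite (neq _ js) (edge_val_upd _ _ _ ikept (pruned_ok inv js)).
  exact: (pruned_tracks inv js).
- move=> j; rewrite inE => /predU1P[->|js].
    by rewrite (pruned_fresh inv) // /edge_ok /= mem_head.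
  apply: edge_ok_sub (pruned_ok inv js) => l lk.
  by rewrite inE lk orbT.
- by move=> l; rewrite inE negb_or => /andP[_]; apply: (pruned_fresh inv).
- move=> j; rewrite inE /upd => /predU1P[->|jk]; first by rewrite eqxx.
  have /andP[js _] := pruned_kept inv jk.
  by rewrite (neq _ js); apply: (pruned_monomial inv).
- move=> j; rewrite !inE => /predU1P[->|/(pruned_kept inv)/andP[-> ->]].
    by rewrite eqxx; apply: contra iseen => /(pruned_deleted inv).
  by rewrite orbT.
by move=> j /(pruned_deleted inv) js; rewrite inE js orbT.
Qed.

Lemma delete_step seen D kept envV envW subst g e : pruned seen D kept envV envW subst ->
  gname g \notin seen -> edge_ok seen (lhs g) -> edge_ok seen (rhs g) ->
  process C eta envW (resolved subst g) = Delete e ->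
  pruned (gname g :: seen) (gname g :: D) kept
      (upd envV (gname g) (gate_val src delta envV g)) envW (upd subst (gname g) e).
Proof.
move=> inv iseen lok rok eE.
have := process_tracks eta_ge0 eta_rep inv lok rok; rewrite eE.
move=> [/= e_input Ve].
have neq j : j \in seen -> (j == gname g) = false.
  by move=> js; apply: contraNF iseen => /eqP <-.
have eok : edge_ok kept e.
  case: e_input => [->|[s ->]]; rewrite ?edge_ok_flip; exact: (edge_resolve_ok inv).
have vanish_sub (y : 'I_(n + N) -> R) : vanish (gname g :: D) y -> vanish D y.
  by move=> yD j jD; apply: yD; rewrite inE jD orbT.
split.
- exact: rounded_step (pruned_rounded inv) iseen lok rok.
- move=> j; rewrite inE {1}/upd => /predU1P[->|js].
    rewrite eqxx /upd eqxx (gate_val_unrounded C eta envV g) -[X in tracks _ _ X]mulr1.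
    have di : tracks (vanish (gname g :: D)) (1 + delta (gname g)) 1.
      by apply: tracks_rounding_deleted => y; apply; rewrite mem_head.
    exact: tracksM (tracks_sub vanish_sub Ve) di.
  rewrite (neq _ js) /upd (neq _ js).
  exact: tracks_sub vanish_sub (pruned_tracks inv js).
- move=> j; rewrite inE /upd => /predU1P[->|js]; first by rewrite eqxx.
  by rewrite (neq _ js); apply: (pruned_ok inv js).
- move=> l; rewrite inE negb_or /upd => /andP[/negPf-> ls].
  exact: (pruned_fresh inv).
- exact: (pruned_monomial inv).
- move=> j jk; have /andP[js jD] := pruned_kept inv jk.
  by rewrite !inE js orbT (neq _ js).
move=> j; rewrite !inE => /predU1P[->|/(pruned_deleted inv)->]; first by rewrite eqxx.
by rewrite orbT.
Qed.

Lemma prune_gates_pruned gs seen D kept envV envW subst :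
  pruned seen D kept envV envW subst -> gates_ok seen gs ->
  let r := prune_gates C eta envW subst gs in
  gates_ok kept r.1 /\
  exists D', pruned (catrev (map (@gname n N) gs) seen) D'
    (catrev (map (@gname n N) r.1) kept)
    (run src delta envV gs) (run src delta envW r.1) r.2.
Proof.
elim: gs seen D kept envV envW subst => [|g gs IHgs] seen D kept envV envW subst inv /=.
  by split=> //; exists D.
case/and4P=> iseen lok rok gsok; rewrite -/(resolved subst g).
case fE: process => [k|e].
  have [kg] := keep_step inv iseen lok rok fE.
  rewrite /= andbT => kok inv'; have [rok' [D' inv'']] := IHgs _ _ _ _ _ _ inv' gsok.
  move: kok => /= /and3P[-> -> ->]; rewrite kg; split=> //.
  by exists D'.
exact: IHgs _ _ _ _ _ _ (delete_step inv iseen lok rok fE) gsok.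
Qed.

Lemma pruned_nil : pruned [::] [::] [::] (fun=> 0) (fun=> 0) (fun i => Edge false (inr i)).
Proof. by []. Qed.

(** The output is an edge that enters no node, so that it is never redirected:
    its value can fail to be homogeneous when it starts at a source. *)
Lemma prune_gates_tracks (P : algorithm n N) : is_dag P ->
  let r := prune_gates C eta (fun=> 0) (fun i => Edge false (inr i)) (gates P) in
  let o := resolve r.2 (out P) in
  let W := edge_val src (run src delta (fun=> 0) r.1) o in
  [/\ gates_ok [::] r.1, edge_ok (map (@gname n N) r.1) o,
      is_source o \/ monomial W &
      exists D, tracks (vanish D) (output src delta P) W /\
                forall i, i \in map (@gname n N) r.1 -> i \notin D].
Proof.
move=> /andP[gok ook] r o W.
have [rok [D inv]] := prune_gates_pruned pruned_nil gok.
have {}ook : edge_ok (catrev [seq gname g | g <- gates P] [::]) (out P).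
  by apply: edge_ok_sub ook => i; rewrite catrevE cats0 mem_rev.
have rout := edge_resolve_ok inv ook; split=> //.
- by apply: edge_ok_sub rout => i; rewrite catrevE cats0 mem_rev.
- case: (boolP (is_source o)) => [|os]; [by left|right].
  exact: (edge_monomial inv rout).
exists D; split; first exact: (edge_tracks inv ook).
move=> i ir; have := pruned_kept inv (j := i); rewrite catrevE cats0 mem_rev.
by move=> /(_ ir)/andP[].
Qed.

End PruneGates.

(** * Dead nodes *)

Section LiveGates.
Variables n N : nat.
Implicit Types (e o : edge n N) (gs : seq (gate n N)).

Lemma live_gates_out gs o i : i \in origins o -> i \in (live_gates gs o).2.
Proof.
by move=> io; elim: gs => //= g gs IHgs; case: ifP; rewrite ?inE ?IHgs.
Qed.

Lemma live_gates_names gs o i : i \in origins o -> i \in map (@gname n N) gs ->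
  i \in map (@gname n N) (live_gates gs o).1.
Proof.
move=> io; elim: gs => //= g gs IHgs; rewrite inE.
case: ifP => ilive; rewrite ?inE => /predU1P[ig|/IHgs->]; rewrite ?orbT //.
  by rewrite ig eqxx.
by rewrite -ig live_gates_out in ilive.
Qed.

Lemma live_gates_ok gs o seen seen' : gates_ok seen gs ->
  (forall i, i \in seen' -> i \in seen) ->
  (forall i, i \in seen -> i \in (live_gates gs o).2 -> i \in seen') ->
  gates_ok seen' (live_gates gs o).1.
Proof.
elim: gs seen seen' => //= g gs IHgs seen seen' /and4P[iseen lok rok gsok] sub.
case: ifP => ilive /= live; last first.
  apply: IHgs gsok _ _ => [i /sub si|i]; first by rewrite inE si orbT.
  by rewrite inE => /predU1P[->|]; [rewrite ilive | apply: live].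
have edge_live e : edge_ok seen e -> (forall i, i \in origins e -> i \in
    (live_gates gs o).2 :|: origins (lhs g) :|: origins (rhs g)) -> edge_ok seen' e.
  rewrite /edge_ok /origins; case: (org e) => // i si elive; apply: live => //.
  by apply: elive; rewrite inE.
have -> : gname g \notin seen' by apply: contra iseen => /sub.
rewrite !edge_live //; try by move=> i il; rewrite !inE il ?orbT.
apply: IHgs gsok _ _ => i; rewrite !inE; first by case/predU1P=> [->|/sub->]; rewrite ?eqxx ?orbT.
case/predU1P=> [->|si il]; first by rewrite eqxx.
by rewrite (live i) ?orbT // !inE il.
Qed.

(** Dead nodes are never read: at each step the two environments need to agree
    only on the nodes that the remaining gates use. *)
Lemma run_live (A : nzRingType) (src : 'I_n -> A) delta gs o env env' :
  (forall i, i \in (live_gates gs o).2 -> env i = env' i) ->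
  forall i, i \in origins o ->
  run src delta env (live_gates gs o).1 i = run src delta env' gs i.
Proof.
elim: gs env env' => [|g gs IHgs] env env' /= EE' i io; first exact: EE'.
case: ifP EE' => ilive /= EE'; last first.
  apply: IHgs => // j jl; rewrite /upd; case: eqP jl => [->|_ jl]; first by rewrite ilive.
  exact: EE'.
apply: IHgs => // j jl; rewrite /upd; case: eqP => _; last by apply: EE'; rewrite !inE jl.
have edgeE e : (forall k, k \in origins e -> env k = env' k) ->
    edge_val src env e = edge_val src env' e.
  rewrite /edge_val /origins; case: (org e) => // k /(_ k) -> //.
  by rewrite inE.
rewrite /gate_val !edgeE // => k kl; apply: EE'; rewrite !inE kl ?orbT //.
Qed.

End LiveGates.

(** * The polynomial along the curve *)

Section Coordinates.
Variables (n : nat) (C : chains n).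

Lemma raddf_old_coord (A B : zmodType) (f : {additive A -> B}) (y : 'I_n -> A) i :
  f (old_coord C y i) = old_coord C (f \o y) i.
Proof. by rewrite /old_coord; case: ifP => //= _; rewrite raddfD; case: sgn; rewrite //= raddfN. Qed.

Lemma raddf_new_coord (A B : zmodType) (f : {additive A -> B}) (y : 'I_n -> A) i :
  f (new_coord C y i) = new_coord C (f \o y) i.
Proof. by rewrite /new_coord; case: ifP => //= _; rewrite raddfB; case: sgn; rewrite //= raddfN. Qed.

Lemma eq_old_coord (A : zmodType) (y z : 'I_n -> A) : y =1 z ->
  old_coord C y =1 old_coord C z.
Proof. by move=> yz i; rewrite /old_coord !yz. Qed.

Lemma eq_new_coord (A : zmodType) (y z : 'I_n -> A) : y =1 z ->
  new_coord C y =1 new_coord C z.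
Proof. by move=> yz i; rewrite /new_coord !yz. Qed.

Lemma new_coordK (A : zmodType) (x : 'I_n -> A) : old_coord C (new_coord C x) =1 x.
Proof.
move=> i; rewrite /old_coord /new_coord rep_idem eqxx.
by case: eqP => // _; rewrite subrK.
Qed.

Lemma old_coordK (A : zmodType) (x : 'I_n -> A) : new_coord C (old_coord C x) =1 x.
Proof.
move=> i; rewrite /old_coord /new_coord rep_idem eqxx.
by case: eqP => // _; rewrite addrK.
Qed.

Variables (R : realType).

Lemma meval_in_new_coords (p : {mpoly R[n]}) (y : 'I_n -> R) :
  (in_new_coords p C).@[y] = p.@[old_coord C y].
Proof.
rewrite /in_new_coords comp_mpoly_meval; apply: meval_eq => i.
rewrite tnth_mktuple (raddf_old_coord (meval y)).
by apply: eq_old_coord => j /=; rewrite mevalXU.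
Qed.

Lemma meval_in_old_coords (p : {mpoly R[n]}) (x : 'I_n -> R) :
  (in_old_coords p C).@[x] = p.@[new_coord C x].
Proof.
rewrite /in_old_coords comp_mpoly_meval; apply: meval_eq => i.
rewrite tnth_mktuple (raddf_new_coord (meval x)).
by apply: eq_new_coord => j /=; rewrite mevalXU.
Qed.

End Coordinates.

Section DominantTerm.
Variables (R : realType) (n N : nat) (p : {mpoly R[n]}) (S C : chains n).
Variables (Lj : seq 'X_{1..n}) (eta : 'I_n -> R) (l0 : 'X_{1..n}).
Notation tpoly := {malg {mpoly R[n + N]}[texp R]}.
Notation I := (index_set S).
Hypothesis eta_cone : exponent_cone I (exponents p S C) Lj eta.
Hypothesis Lj_sub : forall l, l \in Lj -> l \in exponents p S C.
Hypothesis l0Lj : l0 \in Lj.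

Let q := in_new_coords p C.

(** The dominant term in the new coordinates. *)
Definition dominant_new : {mpoly R[n]} :=
  \sum_(m <- msupp q | restrict I m \in Lj) q@_m *: 'X_[m].

Lemma meval_dominant_term x : (dominant_term p S C Lj).@[x] = dominant_new.@[new_coord C x].
Proof. exact: meval_in_old_coords. Qed.

Lemma dominant_new_coeff m :
  dominant_new@_m = if restrict I m \in Lj then q@_m else 0.
Proof.
rewrite /dominant_new raddf_sum /= big_mkcond /=.
have off k : k != m -> (if restrict I k \in Lj then (q@_k *: 'X_[k])@_m else 0) = 0.
  by move=> km; rewrite mcoeffZ mcoeffX (negPf km) mulr0 if_same.
case: (boolP (m \in msupp q)) => mq.
  rewrite (bigD1_seq m) ?msupp_uniq //= mcoeffZ mcoeffX eqxx mulr1.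
  by rewrite big1_seq ?addr0 // => k /andP[km _]; apply: off.
rewrite big1_seq ?(memN_msupp_eq0 mq) ?if_same // => k /andP[_ kq].
by apply: off; apply: contraNneq mq => <-.
Qed.

Lemma dominant_new_neq0 : dominant_new != 0.
Proof.
have := Lj_sub l0Lj; rewrite mem_undup => /mapP[m mq l0m].
apply/eqP => /(congr1 (fun p => p@_m)); rewrite dominant_new_coeff -l0m l0Lj mcoeff0.
by apply/eqP; rewrite -mcoeff_msupp.
Qed.

Lemma cone_ge0 i : 0 <= eta i.
Proof. by have [[_ H] _ _] := eta_cone. Qed.

Lemma pairing_ge0 m : 0 <= pairing eta (vec R m).
Proof. by apply: sumr_ge0 => i _; rewrite mulr_ge0 ?cone_ge0 ?ler0n. Qed.

Definition texp_of m : texp R := insubd (texp0 R) (pairing eta (vec R m)).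

Lemma val_texp_of m : val (texp_of m) = pairing eta (vec R m).
Proof. by rewrite /texp_of val_insubd pairing_ge0. Qed.

Lemma pairing_restrict m : pairing eta (vec R (restrict I m)) = pairing eta (vec R m).
Proof.
apply: eq_bigr => i _; rewrite /vec mnmE; case: ifPn => // iI.
by have [[H _] _ _] := eta_cone; rewrite H // !mul0r.
Qed.

Lemma restrict_exponents m : m \in msupp q -> restrict I m \in exponents p S C.
Proof. by move=> mq; rewrite mem_undup map_f. Qed.

Lemma texp_of_dominant m : restrict I m \in Lj -> texp_of m = texp_of l0.
Proof.
move=> mLj; apply: val_inj; rewrite !val_texp_of -pairing_restrict.
by have [_ H _] := eta_cone; apply: H.
Qed.

Lemma texp_of_other m : m \in msupp q -> restrict I m \notin Lj ->
  val (texp_of l0) < val (texp_of m).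
Proof.
move=> mq mLj; rewrite !val_texp_of -[ltRHS]pairing_restrict.
by have [_ _ H] := eta_cone; apply: H => //; apply: restrict_exponents.
Qed.

Definition letters m : {mpoly R[n + N]} := \prod_(i < n) 'X_(lshift N i) ^+ m i.

(** The value of the polynomial on the curve, whose new coordinates are
    [t ^ eta_i x_i]. *)
Definition on_curve : tpoly :=
  \sum_(m <- msupp q) << q@_m *: letters m *g texp_of m >>.

Definition old_letters (y : 'I_(n + N) -> R) : 'I_n -> R := fun i => y (lshift N i).

Lemma meval_letters y m : (letters m).@[y] = \prod_i old_letters y i ^+ m i.
Proof.
by rewrite /letters rmorph_prod /=; apply: eq_bigr => i _; rewrite rmorphXn /= mevalXU.
Qed.

Definition curve_point (y : 'I_(n + N) -> R) s : 'I_n -> R :=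
  old_coord C (fun i => expR (s * eta i) * old_letters y i).

Lemma evalt_on_curve y s : evalt y s on_curve = p.@[curve_point y s].
Proof.
rewrite -meval_in_new_coords -/q mevalE /on_curve raddf_sum /=.
apply: eq_bigr => m _; rewrite evalt_mono mevalZ meval_letters -mulrA; congr (_ * _).
rewrite val_texp_of mulr_sumr expR_sum mulrC -big_split /=; apply: eq_bigr => i _.
rewrite exprMn; congr (_ * _).
by rewrite -expRM_natr mulrA.
Qed.

Lemma on_curve_coeff y v : (cf v on_curve).@[y] =
  \sum_(m <- msupp q | texp_of m == v) q@_m * \prod_i old_letters y i ^+ m i.
Proof.
rewrite /on_curve raddf_sum /= raddf_sum /= [RHS]big_mkcond.
apply: eq_bigr => m _; rewrite monalg.mcoeffU mevalMn mevalZ meval_letters.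
by case: eqP.
Qed.

Lemma on_curve_below y e : val e < val (texp_of l0) -> (cf e on_curve).@[y] = 0.
Proof.
move=> el0; rewrite on_curve_coeff big1_seq // => m /andP[/eqP me mq].
move: el0; rewrite -me; case: (boolP (restrict I m \in Lj)) => mLj.
  by rewrite texp_of_dominant // ltxx.
by rewrite ltNge ltW // texp_of_other.
Qed.

Lemma on_curve_lead y : (cf (texp_of l0) on_curve).@[y] = dominant_new.@[old_letters y].
Proof.
rewrite on_curve_coeff /dominant_new raddf_sum /= big_seq_cond [RHS]big_seq_cond.
apply: eq_big => [m|m _]; last by rewrite mevalZ mevalX.
case: (boolP (m \in msupp q)) => //= mq.
case: (boolP (restrict I m \in Lj)) => mLj; first by rewrite texp_of_dominant // eqxx.
by rewrite (val_lt_neq (texp_of_other mq mLj)).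
Qed.

Lemma evalt_curve y s i : evalt y s (@curve R n N C eta i) = curve_point y s i.
Proof.
rewrite (raddf_old_coord C (evalt y s)); apply: eq_old_coord => j /=.
by rewrite evalt_mono mevalXU val_insubd cone_ge0 mulrC.
Qed.

Lemma evalt_delta y s j : evalt y s (@tdelta R n N j) = y (rshift n j).
Proof. by rewrite evalt_mono mevalXU /= mulr0 expR0 mulr1. Qed.

Variable P : algorithm n N.
Hypothesis P_accurate : evaluates_accurately P p.

Let V : tpoly := output (@curve R n N C eta) (@tdelta R n N) P.

Lemma evalt_output y s :
  evalt y s V = output (curve_point y s) (fun j => y (rshift n j)) P.
Proof.
by apply: rmorph_output => [i|j _]; [apply: evalt_curve | apply: evalt_delta].
Qed.

Lemma output_exact (y : 'I_(n + N) -> R) s : (forall j, y (rshift n j) = 0) ->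
  evalt y s V = evalt y s on_curve.
Proof.
move=> y0; have [_ P_exact _] := P_accurate.
rewrite evalt_output evalt_on_curve -P_exact.
by apply: (rmorph_output (f := idfun)) => //= j _; rewrite y0.
Qed.

Lemma output_close th : 0 < th < 1 -> exists2 eps, 0 < eps < 1 &
  forall (y : 'I_(n + N) -> R) s, (forall j, `|y (rshift n j)| <= eps) ->
    `|evalt y s (V - on_curve)| <= th * `|evalt y s on_curve|.
Proof.
move=> th01; have [_ _ /(_ th th01)[eps eps01 H]] := P_accurate.
exists eps => // y s yeps; rewrite rmorphB /= evalt_output evalt_on_curve.
exact: H.
Qed.

Definition with_letters (X : 'I_n -> R) (d : 'I_N -> R) (k : 'I_(n + N)) : R :=
  match fintype.split k with inl i => X i | inr j => d j end.

Lemma with_lettersl X d i : with_letters X d (lshift N i) = X i.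
Proof. by rewrite /with_letters (unsplitK (inl i)). Qed.

Lemma with_lettersr X d j : with_letters X d (rshift n j) = d j.
Proof. by rewrite /with_letters (unsplitK (inr j)). Qed.

Lemma dominant_point : exists2 y : 'I_(n + N) -> R,
  (forall j, y (rshift n j) = 0) & dominant_new.@[old_letters y] != 0.
Proof.
have [X _ Xdom] := mpoly_nonvanishing dominant_new_neq0 ltr01.
exists (with_letters X (fun=> 0)); first exact: with_lettersr.
by rewrite (meval_eq (v2 := X)) // => i; apply: with_lettersl.
Qed.

(** Accuracy forces the output to have the same lowest degree along the curve as
    the polynomial: a lower one would make the relative error unbounded, and a
    higher one is impossible without rounding errors. *)
Lemma output_lowest : lowest V (texp_of l0).
Proof.
have [y0 y00 dom0] := dominant_point.
have V0 : V != 0.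
  apply: contraNneq dom0 => V0; rewrite -on_curve_lead -normr_le0.
  apply: le_trans (evalt_dominated (K := 0) (G := 0) _ _ _ _) _ => //.
  - move=> s _; rewrite -output_exact // V0.
    by rewrite rmorph0 normr0 mulr0.
  - by move=> e; apply: on_curve_below.
  - by move=> e _; rewrite monalg.mcoeff0 meval0.
  by rewrite mul0r.
have [v Vv] := lowest_exists V0; have [Vn Vb] := Vv.
(* Both strict inequalities between the two degrees are refuted, the first
   without rounding errors and the second with the error bound for [1/2]. *)
suff -> : texp_of l0 = v by [].
apply: val_inj; case: (ltgtP (val (texp_of l0)) (val v)) => // lt.
  case/negP: dom0; rewrite -on_curve_lead -normr_le0.
  apply: le_trans (evalt_dominated (K := 1) (G := V) ler01 _ _ _) _.
  - by move=> s _; rewrite mul1r output_exact.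
  - by move=> e; apply: on_curve_below.
  - by move=> e el; rewrite Vb ?meval0 // (lt_trans el lt).
  by rewrite Vb // meval0 normr0 mulr0.
have half01 : 0 < (2^-1 : R) < 1 by rewrite invr_gt0 ltr0n invf_lt1 ?ltr0n ?ltr1n.
have [eps /andP[eps0 _] close] := output_close half01.
have [y yeps /negP[]] := mpoly_nonvanishing Vn eps0.
rewrite -normr_le0.
apply: le_trans (evalt_dominated (K := 2) (G := on_curve) _ _ _ _) _ => //.
- move=> s _; have := close y s (fun j => yeps (rshift n j)); rewrite rmorphB /= => h.
  rewrite -[evalt y s V](subrK (evalt y s on_curve)).
  apply: le_trans (ler_normD _ _) _.
  rewrite (_ : 2 = 1 + 1 :> R) // mulrDl !mul1r lerD2r.
  by apply: le_trans h _; rewrite ler_piMl // ltW //; case/andP: half01.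
- by move=> e ev; rewrite Vb // meval0.
- by move=> e ev; rewrite on_curve_below // (lt_trans ev lt).
by rewrite on_curve_below // normr0 mulr0.
Qed.

Lemma output_lead_dominated y K : 0 <= K ->
  (forall s, `|evalt y s (V - on_curve)| <= K * `|evalt y s on_curve|) ->
  `|(cf (texp_of l0) V).@[y] - dominant_new.@[old_letters y]| <=
    K * `|dominant_new.@[old_letters y]|.
Proof.
have [_ Vb] := output_lowest.
move=> K0 dom; rewrite -!on_curve_lead -mevalB -monalg.mcoeffB.
apply: evalt_dominated => // e el; last exact: on_curve_below.
by rewrite monalg.mcoeffB mevalB on_curve_below // Vb // meval0 subrr.
Qed.

Lemma output_lead_exact y : (forall j, y (rshift n j) = 0) ->
  (cf (texp_of l0) V).@[y] = dominant_new.@[old_letters y].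
Proof.
move=> y0; apply/eqP; rewrite -subr_eq0 -normr_le0.
apply: le_trans (output_lead_dominated (K := 0) _ _) _ => //.
  by move=> s; rewrite rmorphB /= output_exact // subrr normr0 mul0r.
by rewrite mul0r.
Qed.

Lemma output_lead_close th : 0 < th < 1 -> exists2 eps, 0 < eps < 1 &
  forall y : 'I_(n + N) -> R, (forall j, `|y (rshift n j)| <= eps) ->
    `|(cf (texp_of l0) V).@[y] - dominant_new.@[old_letters y]| <=
      th * `|dominant_new.@[old_letters y]|.
Proof.
move=> th01; have [eps eps01 close] := output_close th01.
exists eps => // y yeps; apply: output_lead_dominated => [|s]; last exact: close.
by case/andP: th01 => /ltW.
Qed.

Lemma tracks_output_coeff D W : tracks (vanish D) V W ->
  [/\ cf (texp_of l0) W != 0, vanishes_below W (texp_of l0) &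
      forall y, vanish D y -> (cf (texp_of l0) V).@[y] = (cf (texp_of l0) W).@[y]].
Proof.
have Vl0 := output_lowest; case=> [[V0 _]|[v [Vv Wv VW]]].
  by case: Vl0; rewrite V0 monalg.mcoeff0 eqxx.
have vE : v = texp_of l0.
  have := lowest_lowdeg Vv; rewrite (lowest_lowdeg Vl0) => -[E].
  by apply: val_inj.
rewrite -vE; split=> //; have [y y0 dom] := dominant_point.
apply: contraNneq dom => W0; rewrite -output_lead_exact // -vE.
by rewrite VW ?W0 ?meval0 // => i _; apply: y0.
Qed.

(** For a homogeneous output, the value at [t = 1] is the coefficient of its only
    term. *)
Lemma tracks_monomial_output D W y : tracks (vanish D) V W -> monomial W ->
  vanish D y -> evalt y 0 W = (cf (texp_of l0) V).@[y].
Proof.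
move=> /tracks_output_coeff[Wn _ VW] [a [v Wav]] yD; rewrite VW //.
move: Wn; rewrite Wav monalg.mcoeffU evalt_mono mul0r expR0 mulr1.
by case: (v =P _) => [_ _|_]; rewrite ?mulr1n // mulr0n eqxx.
Qed.

End DominantTerm.

(** * Linear polynomials *)

Section Linear.
Variables (R : realType) (n : nat).
Implicit Types (p q : {mpoly R[n]}) (x y : 'I_n -> R).

Lemma dhomog1E p : p \is 1.-homog ->
  forall x, p.@[x] = \sum_i p@_(U_(i)%MM) * x i.
Proof.
move=> p1 x; have -> : \sum_i p@_(U_(i)%MM) * x i =
    (\sum_i p@_(U_(i)%MM) *: 'X_i : {mpoly R[n]}).@[x].
  by rewrite raddf_sum /=; apply: eq_bigr => i _; rewrite mevalZ mevalXU.
congr _.@[x]; apply/mpolyP => m; rewrite raddf_sum /=.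
have [/mdeg1P[j /eqP->]|m1] := boolP (mdeg m == 1%N); last first.
  rewrite (dhomog_nemf_coeff p1 m1) big1 // => i _.
  rewrite mcoeffZ mcoeffX; case: (_ =P m) m1 => [<-|_ _]; last by rewrite mulr0.
  by rewrite mdeg1.
rewrite (bigD1 j) //= mcoeffZ mcoeffX eqxx mulr1 big1 ?addr0 // => i ij.
rewrite mcoeffZ mcoeffX; case: (_ =P _) => [ij_eq|_]; last by rewrite mulr0.
have := congr1 (fun m : 'X_{1..n} => m i) ij_eq.
by rewrite !mnm1E eqxx eq_sym (negPf ij).
Qed.

(** On a line the two multinomials become polynomials in one variable, over an
    integral domain. *)
Lemma line_domain p q x y : (forall s : R, p.@[fun i => x i + s * (y i - x i)] = 0 \/
    q.@[fun i => x i + s * (y i - x i)] = 0) -> p.@[x] = 0 \/ q.@[y] = 0.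
Proof.
move=> pq.
pose line r : {mpoly R[1]} :=
  r \mPo [tuple (x i)%:MP + (y i - x i) *: 'X_ord0 | i < n].
have lineE r z : (line r).@[z] = r.@[fun i => x i + z ord0 * (y i - x i)].
  rewrite /line comp_mpoly_meval; apply: meval_eq => i.
  by rewrite tnth_mktuple mevalD mevalC mevalZ mevalXU mulrC.
have : line p * line q = 0.
  apply: mpoly_eq => z; rewrite mevalM !lineE meval0.
  by case: (pq (z ord0)) => ->; rewrite ?mul0r ?mulr0.
move/eqP; rewrite mulf_eq0 => /orP[/eqP l0|/eqP l0]; [left|right].
  have := lineE p (fun=> 0); rewrite l0 meval0 => ->.
  by apply: meval_eq => i; rewrite mul0r addr0.
have := lineE q (fun=> 1); rewrite l0 meval0 => ->.
by apply: meval_eq => i; rewrite mul1r addrC subrK.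
Qed.

(** Two points of a hyperplane are joined by a line inside it, and two closed
    sets that each miss one of these points cannot cover the line. *)
Lemma variety_linear_irreducible p : p \is 1.-homog -> irreducible (variety p).
Proof.
move=> p1; split.
- by exists (set1 p); rewrite bigcap_set1.
- exists (fun=> 0); rewrite /variety /= dhomog1E // big1 // => i _.
  by rewrite mulr0.
move=> B1 B2 [Q1 ->] [Q2 ->] cover; apply: contrapT => /not_orP[].
move=> /existsNP[x /not_implyP[px /existsNP[r1 /not_implyP[Q1r1 r1x]]]].
move=> /existsNP[y /not_implyP[py /existsNP[r2 /not_implyP[Q2r2 r2y]]]].
suff [] : r1.@[x] = 0 \/ r2.@[y] = 0 by [].
apply: line_domain => s.
have : variety p (fun i => x i + s * (y i - x i)).
  move: px py; rewrite /variety /= !dhomog1E // => px py.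
  transitivity ((1 - s) * (\sum_i p@_(U_(i)%MM) * x i) + s * (\sum_i p@_(U_(i)%MM) * y i)).
    rewrite !mulr_sumr -big_split /=; apply: eq_bigr => i _.
    by rewrite mulrCA [s * (_ * _)]mulrCA -mulrDr mulrBl mul1r mulrBr addrA addrAC.
  by rewrite px py !mulr0 addr0.
by move=> /cover[H|H]; [left; apply: H Q1r1 | right; apply: H Q2r2].
Qed.

End Linear.

(** * Faces of the Newton polytope *)

Section Faces.
Variables (R : realType) (n : nat).
Implicit Types (L : seq 'X_{1..n}) (et : 'I_n -> R).

Lemma vec_hull L l : uniq L -> l \in L -> hull L (vec R l).
Proof.
move=> Lu lL; exists (fun k => (k == l)%:R); split.
- by move=> k _; rewrite ler0n.
- rewrite (bigD1_seq l) //= eqxx big1_seq ?addr0 // => k /andP[/negPf->] //.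
move=> i; rewrite (bigD1_seq l) //= eqxx mul1r big1_seq ?addr0 // => k /andP[/negPf-> _].
by rewrite mul0r.
Qed.

(** A linear form attains its maximum over a polytope at a vertex: a convex
    combination of smaller values cannot reach it. *)
Lemma face_exponent I L (F : set ('I_n -> R)) : uniq L -> face I (hull L) F ->
  exists2 l, l \in L & F (vec R l).
Proof.
move=> Lu [[y Fy] [et _ FE]]; move: Fy; rewrite FE => -[hy ymax].
have [w [w0 w1 yE]] := hy.
have pairE : pairing et y = \sum_(l <- L) w l * pairing et (vec R l).
  rewrite /pairing; under eq_bigr do rewrite yE mulr_sumr.
  rewrite exchange_big /=; apply: eq_bigr => l _; rewrite mulr_sumr.
  by apply: eq_bigr => i _; rewrite mulrCA.
case: (boolP (has (fun l => pairing et (vec R l) == pairing et y) L)).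
  move=> /hasP[l lL /eqP lmax]; exists l => //; split; first exact: vec_hull.
  by move=> z /ymax; rewrite lmax.
move=> /hasPn nomax; exfalso.
have sum0 : \sum_(l <- L) w l * (pairing et y - pairing et (vec R l)) = 0.
  under eq_bigr do rewrite mulrBr.
  by rewrite sumrB -mulr_suml w1 mul1r pairE subrr.
have gap l : l \in L -> 0 < pairing et y - pairing et (vec R l).
  by move=> lL; rewrite subr_gt0 lt_neqAle nomax // ymax //; apply: vec_hull.
have : \sum_(l <- L) w l = 0.
  rewrite big1_seq // => l /andP[_ lL].
  move/eqP: sum0; rewrite big_seq psumr_eq0 => [/allP/(_ l lL)|k kL].
    by rewrite lL /= mulf_eq0 (gt_eqF (gap _ lL)) orbF => /eqP.
  by rewrite mulr_ge0 ?w0 // ltW ?gap.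
by rewrite w1 => /eqP; rewrite oner_eq0.
Qed.

End Faces.

(** * Outputs that are sources *)

Lemma dhomog_in_new_coords (R : realType) (n d : nat) (p : {mpoly R[n]}) (C : chains n) :
  p \is d.-homog -> in_new_coords p C \is d.-homog.
Proof.
move=> pd; rewrite /in_new_coords comp_mpolyEX big_seq; apply: rpred_sum => m mp.
apply: dhomogZ; rewrite comp_mpolyX -(dhomog_mf pd mp) /= mdegE.
elim/big_ind2: _ => [||i _]; first exact: dhomog1.
  by move=> a d1 b d2; apply: dhomogM.
rewrite -[X in X.-homog]mul1n tnth_mktuple; apply: dhomogMn.
have X1 (k : 'I_n) : 'X_k \is [in R[n], 1.-homog] by rewrite dhomogX /= mdeg1.
rewrite /old_coord; case: ifP => // _; apply: dhomogD => //.
by case: sgn; rewrite //= dhomogN.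
Qed.

Section SourceOutput.
Variables (R : realType) (n d N : nat) (p : {mpoly R[n]}) (S C : chains n).
Variables (Lj : seq 'X_{1..n}) (eta : 'I_n -> R) (l0 : 'X_{1..n}).
Notation tpoly := {malg {mpoly R[n + N]}[texp R]}.
Notation src := (@curve R n N C eta).
Hypothesis p_homogeneous : p \is d.-homog.
Hypothesis S_component : irreducible_component (locus R S) (variety p).
Hypothesis C_standard : standard_change R S C.
Hypothesis eta_cone : exponent_cone (index_set S) (exponents p S C) Lj eta.
Hypothesis eta_rep : forall r, eta (rep C r) <= eta r.
Hypothesis Lj_sub : forall l, l \in Lj -> l \in exponents p S C.
Hypothesis l0Lj : l0 \in Lj.
Let q := in_new_coords p C.
Let dom := dominant_new p S C Lj.

Lemma dhomog_dominant_new : dom \is d.-homog.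
Proof.
rewrite /dom /dominant_new big_seq_cond; apply: rpred_sum => m /andP[mq _].
apply: dhomogZ; rewrite dhomogX; apply/eqP.
exact: dhomog_mf (dhomog_in_new_coords C p_homogeneous) _ mq.
Qed.

(** If the lowest coefficient were plus or minus a representative whose chain
    contains a variable of higher exponent, then [p] would be linear, and its
    variety, being an irreducible hyperplane, would be the component itself; but
    the component lies in another hyperplane. *)
Lemma dominant_not_representative s r : eta (rep C r) < eta r ->
  ~ (forall X : 'I_n -> R, dom.@[X] = signed s (X (rep C r))).
Proof.
set k := rep C r => lt domE.
have domX : dom = signed s 'X_k.
  by apply: mpoly_eq => X; rewrite domE; case: (s) => /=; rewrite ?mevalN mevalXU.
have d1 : d = 1%N.
  apply: dhomog_uniq (dominant_new_neq0 Lj_sub l0Lj) dhomog_dominant_new _.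
  by rewrite -/dom domX; case: (s); rewrite /= ?dhomogN dhomogX /= mdeg1.
have p1 : p \is 1.-homog by rewrite -d1.
have q1 : q \is 1.-homog by apply: dhomog_in_new_coords.
have qk : q@_(U_(k)%MM) != 0.
  have : dom@_(U_(k)%MM) != 0.
    rewrite domX; case: (s) => /=; rewrite ?mcoeffN ?oppr_eq0 mcoeffX eqxx;
    exact: oner_neq0.
  by rewrite /dom dominant_new_coeff; case: ifP => // _; rewrite eqxx.
have rI : r \in index_set S.
  apply: contraTT lt => rI; have [[H H0] _ _] := eta_cone.
  by rewrite (H _ rI) -leNgt H0.
have kr : k != r by apply: contraTneq lt => ->; rewrite ltxx.
(* A zero of [q] with coordinate [r] equal to [1], which the component excludes. *)
pose X i := if i == r then 1 else if i == k then - (q@_(U_(r)%MM) / q@_(U_(k)%MM)) else 0.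
have qX : q.@[X] = 0.
  rewrite dhomog1E // (bigD1 r) //= (bigD1 k) //= big1 => [|i /andP[ir ik]].
    rewrite /X eqxx (negPf kr) eqxx addr0 mulr1 mulrN mulrCA divff // mulr1.
    by rewrite subrr.
  by rewrite /X (negPf ir) (negPf ik) mulr0.
have [_ S_sub S_max] := S_component.
have VS : variety p = locus R S.
  by apply: S_max => //; apply: variety_linear_irreducible.
have xS : locus R S (old_coord C X).
  by rewrite -VS /variety /= -meval_in_new_coords.
have [_ image] := C_standard.
have : (new_coord C @` locus R S)%classic (new_coord C (old_coord C X)).
  by exists (old_coord C X).
rewrite image /= => /(_ r rI).
by rewrite old_coordK /X eqxx => /eqP; rewrite oner_eq0.
Qed.

Variable P : algorithm n N.
Hypothesis P_accurate : evaluates_accurately P p.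

Lemma source_output_monomial D (env : 'I_N -> tpoly) (o : edge n N) : is_source o ->
  tracks (vanish D) (output src (@tdelta R n N) P) (edge_val src env o) ->
  monomial (edge_val src env o).
Proof.
rewrite /is_source; case oE: (org o) => [r|//] _.
move=> /(tracks_output_coeff eta_cone Lj_sub l0Lj P_accurate)[Wn Wb VW].
have eta_ge0 := cone_ge0 eta_cone.
have [lt|nlt] := boolP (eta (rep C r) < eta r); last first.
  by have [a [u [_ ->]]] := source_single eta_rep env oE nlt; exists a, u.
exfalso; move: Wn Wb VW; rewrite (source_double env oE lt).
set s := _ (+) _; set a := signed s _; set u := insubd _ _.
set b := signed _ 'X_(lshift N r); set w := insubd _ (eta r) => Wn Wb VW.
have a0 : a != 0 by rewrite signed_neq0 variable_neq0.
have uw : val u < val w by rewrite 2!(val_eta eta_ge0).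
have Wu := lowest_two b a0 uw.
have l0u : texp_of eta l0 = u.
  have := lowest_lowdeg Wu; rewrite (lowest_lowdeg (conj Wn Wb)) => -[E].
  exact: val_inj.
apply: (dominant_not_representative (s := s) lt) => X.
pose y := with_letters (N := N) X (fun=> 0).
have yD : forall j, y (rshift n j) = 0 by move=> j; apply: with_lettersr.
have yX : dom.@[X] = dom.@[old_letters y].
  by apply: meval_eq => i; rewrite /old_letters /y with_lettersl.
rewrite yX -(output_lead_exact eta_cone Lj_sub l0Lj P_accurate yD) VW; last by move=> j _.
rewrite l0u (coeff_two a b uw) /a -(with_lettersl (N := N) X (fun=> 0) (rep C r)) -/y.
by case: (s) => /=; rewrite ?mevalN mevalXU.
Qed.

End SourceOutput.

Lemma dominant_exponents_exist (R : realType) (n : nat) I (p : {mpoly R[n]}) (S C : chains n) Lj :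
  dominant_exponents R I (exponents p S C) Lj ->
  (forall l, l \in Lj -> l \in exponents p S C) /\ exists l0, l0 \in Lj.
Proof.
move=> [F [faceF LjE _]]; split=> [l /LjE[]//|].
have [l lL Fl] := face_exponent (undup_uniq _) faceF.
by exists l; apply/LjE.
Qed.

Section Pruning.
Variables (R : realType) (n N : nat) (C : chains n) (eta : 'I_n -> R).
Notation tpoly := {malg {mpoly R[n + N]}[texp R]}.

Lemma prune_is_dag (P : algorithm n N) (r := prune_gates C eta (fun=> 0)
    (fun i => Edge false (inr i)) (gates P)) (o := resolve r.2 (out P)) :
  gates_ok [::] r.1 -> edge_ok (map (@gname n N) r.1) o -> is_dag (prune C eta P).
Proof.
move=> rok ook; apply/andP; split; first exact: live_gates_ok rok _ _.
rewrite /= -/r -/o; move: ook; rewrite /edge_ok; case oE: (org o) => [//|i] ir.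
by apply: live_gates_names ir; rewrite /origins oE inE.
Qed.

Lemma prune_output (P : algorithm n N) (A : nzRingType) (src : 'I_n -> A) delta
    (r := prune_gates C eta (fun=> 0) (fun i => Edge false (inr i)) (gates P))
    (o := resolve r.2 (out P)) :
  output src delta (prune C eta P) = edge_val src (run src delta (fun=> 0) r.1) o.
Proof.
rewrite /output /= -/r -/o /edge_val; congr signed.
case oE: (org o) => [//|i].
by apply: run_live => //; rewrite /origins oE inE.
Qed.

End Pruning.

(** * Pruning preserves accuracy *)

Theorem theorem4p44 (R : realType) (n d N : nat) (p : {mpoly R[n]})
    (P : algorithm n N)
    (p_homogeneous : p \is d.-homog)
    (p_allowable : allowable (variety p))
    (P_accurate : evaluates_accurately P p)
    (S C : chains n) (Lj : seq 'X_{1..n})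
    (S_component : irreducible_component (locus R S) (variety p))
    (C_standard : standard_change R S C)
    (Lj_dominant : dominant_exponents R (index_set S) (exponents p S C) Lj)
    (Lj_E : conditionE R (index_set S) (exponents p S C) Lj C) :
  (forall eta : 'I_n -> R,
     exponent_cone (index_set S) (exponents p S C) Lj eta ->
     evaluates_accurately (prune C eta P) (dominant_term p S C Lj))
  /\
  ((exists eta : 'I_n -> R,
      exponent_cone (index_set S) (exponents p S C) Lj eta) ->
   exists (M : nat) (Q : algorithm n M),
     evaluates_accurately Q (dominant_term p S C Lj)).
Proof.
suff accurate (eta : 'I_n -> R) :
    exponent_cone (index_set S) (exponents p S C) Lj eta ->
    evaluates_accurately (prune C eta P) (dominant_term p S C Lj).
  split=> [//|[eta cone]]; exists N, (prune C eta P); exact: accurate.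
move=> cone; have eta_ge0 := cone_ge0 cone; have eta_rep := Lj_E _ cone.
have [Lj_sub [l0 l0Lj]] := dominant_exponents_exist Lj_dominant.
have [P_dag _ _] := P_accurate.
have [rok ook mW [D [VW kept]]] := prune_gates_tracks eta_ge0 eta_rep P_dag.
set r := prune_gates _ _ _ _ _ in rok ook mW VW kept.
set o := resolve _ _ in ook mW VW; set W := edge_val _ _ _ in mW VW.
have {}mW : monomial W.
  case: mW => // so.
  exact: (source_output_monomial p_homogeneous S_component C_standard cone
    eta_rep Lj_sub l0Lj P_accurate so VW).
set V := output _ _ P in VW.
(* The point at which the coefficients are read: the invariant speaks only of
   points where the rounding errors of the deleted nodes vanish. *)
pose y x delta := with_letters (new_coord C x)
  (fun j => if j \in D then 0 else delta j) : 'I_(n + N) -> R.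
have y_letters x delta :
    (dominant_new p S C Lj).@[old_letters (y x delta)] = (dominant_term p S C Lj).@[x].
  rewrite meval_dominant_term.
  by apply: meval_eq => i; rewrite /old_letters /y with_lettersl.
have output_prune x delta : output x delta (prune C eta P) =
    (cf (texp_of eta l0) V).@[y x delta].
  rewrite prune_output -/r -/o.
  rewrite -(tracks_monomial_output cone Lj_sub l0Lj P_accurate VW mW); last first.
    by move=> j jD; rewrite /y with_lettersr jD.
  have src_val i : evalt (y x delta) 0 (@curve R n N C eta i) = x i.
    rewrite (evalt_curve cone) /curve_point -[RHS](new_coordK C).
    apply: eq_old_coord => k; rewrite mul0r expR0 mul1r.
    by rewrite /old_letters /y with_lettersl.
  symmetry; apply: rmorph_edge_val => [|i]; first exact: src_val.
  apply: (rmorph_run (f := evalt (y x delta) 0)) => [|j jr|j]; first exact: src_val.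
    by rewrite /= evalt_delta /y with_lettersr (negPf (kept _ jr)).
  exact: rmorph0.
split.
- exact: prune_is_dag rok ook.
- move=> x; rewrite output_prune -(y_letters x (fun=> 0)).
  apply: (output_lead_exact cone Lj_sub l0Lj P_accurate) => j.
  by rewrite /y with_lettersr if_same.
move=> th th01.
have [eps eps01 close] := output_lead_close cone Lj_sub l0Lj P_accurate th01.
exists eps => // x delta delta_small; rewrite output_prune -(y_letters x delta).
apply: close => j; rewrite /y with_lettersr; case: ifP => // _.
by rewrite normr0 ltW //; case/andP: eps01.
Qed.
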